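(* Let $\mathcal{O}_K$ be a Dedekind domain with fraction field $K$, let $L$ be a finite separable extension of $K$ of degree $d$, and let $\mathcal{O}_L$ be the integral closure of $\mathcal{O}_K$ in $L$. Let $\mathfrak{n}$ be a nonzero square-free ideal of $\mathcal{O}_K$ with $N_K(\mathfrak{n})$ finite. Then $\mathfrak{n}\mathcal{O}_L$ is a Carmichael ideal of $\mathcal{O}_L$ if and only if: (1) $\mathfrak{n}\mathcal{O}_L$ is a composite ideal; (2) $\mathfrak{n}$ is relatively prime to the discriminant $\mathrm{Disc}(L/K)$; (3) for each prime ideal $\mathfrak{p}\mid\mathfrak{n}$ and every prime ideal $\mathfrak{P}$ of $\mathcal{O}_L$ lying above $\mathfrak{p}$, $N_K(\mathfrak{p})^{f(\mathfrak{P})}-1$ divides $N_K(\mathfrak{n})^d-1$, where $f(\mathfrak{P})$ is the residue class degree of $\mathfrak{P}$ in $L/K$.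
   Context: For an ideal $\mathfrak{n}$ of a Dedekind domain $\mathcal{O}_K$, $N_K(\mathfrak{n})=|\mathcal{O}_K/\mathfrak{n}|$. A composite ideal means a nonzero proper ideal that is not a prime ideal. Square-free means every exponent in the prime ideal factorization is $1$. A finite ring $S$ is a Carmichael ring if $S$ is not a field and $a^{|S|}=a$ for every $a\in S$; an ideal $I$ of a ring $R$ is a Carmichael ideal if $R/I$ is a Carmichael ring. $\mathrm{Disc}(L/K)$ is the relative discriminant ideal of $\mathcal{O}_L$ over $\mathcal{O}_K$.
   Formalization: The square-free ideal n is additionally required to be proper: for n = O_K the quotient O_L/nO_L is the zero ring, which literally satisfies the definition of a Carmichael ring while condition (1) fails. *)

(* Defs.v *)
From HB Require Import structures.
From mathcomp Require Import all_boot all_order all_algebra all_field.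
Set Implicit Arguments. Unset Strict Implicit. Unset Printing Implicit Defensive.
Import GRing.Theory.
Local Open Scope ring_scope.

Section RingIdeals.
Variable R : comNzRingType.
Implicit Types S I J P M G : R -> Prop.

Definition subring S :=
  [/\ S 0, S 1, (forall x y, S x -> S y -> S (x - y)) &
      (forall x y, S x -> S y -> S (x * y))].

Definition ideal_of S I :=
  [/\ (forall x, I x -> S x), I 0, (forall x y, I x -> I y -> I (x + y)) &
      (forall r x, S r -> I x -> I (r * x))].

Definition gen_ideal S G (y : R) :=
  exists s : seq (R * R), (forall q, q \in s -> S q.1 /\ G q.2) /\
                          y = \sum_(q <- s) q.1 * q.2.

Definition proper_ideal S I := ideal_of S I /\ ~ I 1.
Definition nonzero_ideal I := exists x, I x /\ x != 0.
Definition prime_ideal S P :=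
  proper_ideal S P /\ forall x y, S x -> S y -> P (x * y) -> P x \/ P y.
Definition maximal_ideal S M :=
  proper_ideal S M /\
  forall J, ideal_of S J -> (forall x, M x -> J x) -> (forall x, J x -> M x) \/ J 1.
Definition prod_ideal S I J :=
  gen_ideal S (fun z => exists a b, I a /\ J b /\ z = a * b).
Definition composite_ideal S I :=
  [/\ nonzero_ideal I, proper_ideal S I & ~ prime_ideal S I].
Definition noetherian S :=
  forall I, ideal_of S I -> exists s : seq R, forall x, I x <-> gen_ideal S (fun g => g \in s) x.

Definition quot_card S I (N : nat) :=
  exists f : 'I_N -> R, [/\ (forall i, S (f i)),
                            (forall i j, I (f i - f j) -> i = j) &
                            (forall x, S x -> exists i, I (x - f i))].
Definition quot_is_field S I :=
  ~ I 1 /\ forall x, S x -> ~ I x -> exists y, S y /\ I (x * y - 1).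
Definition carmichael_ideal S I :=
  exists N, [/\ quot_card S I N, ~ quot_is_field S I &
               forall a, S a -> I (a ^+ N - a)].
Definition coprime_ideals I J := exists a b, [/\ I a, J b & a + b = 1].
End RingIdeals.

Definition integral (K : fieldType) (A : lalgType K) (OK : K -> Prop) (y : A) :=
  exists p : {poly K}, [/\ p \is monic, (forall i, OK p`_i) &
                           (map_poly (in_alg A) p).[y] = 0].

Definition dedekind (K : fieldType) (OK : K -> Prop) :=
  [/\ subring OK,
      (forall x : K, exists a b, [/\ OK a, OK b, b != 0 & x = a / b]),
      noetherian OK,
      (forall x : K, @integral K K^o OK x -> OK x) &
      (forall P, prime_ideal OK P -> nonzero_ideal P -> maximal_ideal OK P)].

Section Ext.
Variables (K : fieldType) (L : fieldExtType K).

Definition intclos (OK : K -> Prop) : L -> Prop := fun y => integral OK y.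

(* Tr_{L/K}: trace of multiplication by y w.r.t. a K-basis of L *)
Definition trLK (y : L) : K :=
  \sum_(i < \dim {:L}) coord (vbasis {:L}) i (y * tnth (vbasis {:L}) i).

Definition disc_elt (x : 'I_(\dim {:L}) -> L) : K :=
  \det (\matrix_(i, j) trLK (x i * x j)).

Definition disc_ideal (OK : K -> Prop) (OL : L -> Prop) : K -> Prop :=
  gen_ideal OK (fun z => exists x, (forall i, OL (x i)) /\ z = disc_elt x).

Definition ext_ideal (OL : L -> Prop) (n : K -> Prop) : L -> Prop :=
  gen_ideal OL (fun z => exists a, n a /\ z = a%:A).

Definition lies_over (OK : K -> Prop) (p : K -> Prop) (P : L -> Prop) :=
  forall a, OK a -> (P a%:A <-> p a).

Definition residue_degree (OK : K -> Prop) (OL : L -> Prop)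
    (p : K -> Prop) (P : L -> Prop) (f : nat) :=
  exists e : 'I_f -> L,
    [/\ (forall i, OL (e i)),
        (forall y, OL y -> exists c : 'I_f -> K,
              (forall i, OK (c i)) /\ P (y - \sum_i c i *: e i)) &
        (forall c : 'I_f -> K, (forall i, OK (c i)) ->
              P (\sum_i c i *: e i) -> forall i, p (c i))].
End Ext.

Definition square_free (K : fieldType) (OK n : K -> Prop) :=
  ~ n 1 /\
  forall p, prime_ideal OK p -> nonzero_ideal p ->
    ~ (forall x, n x -> prod_ideal OK p p x).

(* Main.v *)
Require Import Defs.
From HB Require Import structures.
From mathcomp Require Import all_boot all_order all_algebra all_field.
From mathcomp Require Import perm cyclic fingroup boolp ring.
Set Implicit Arguments. Unset Strict Implicit. Unset Printing Implicit Defensive.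
Import GRing.Theory.
Local Open Scope ring_scope.

(** Near a nonzero prime [p] of [OK], the integral closure [OL] is free of rank [d]: there are [e] in
    [OL^d] and [s] in [OK \ p] with [s OL] contained in the span of [e].  Gluing over the primes
    dividing the square-free ideal [n] shows that [OL/nOL] is free of rank [d] over [OK/n], so it has
    [N(n)^d] elements, and that [nOL] is the intersection of the [pOL].

    The identity [a^N = a] forces [OL/pOL] to be reduced.  If its trace form had a nonzero kernel, that
    kernel would contain a minimal idempotent [eps], on which the trace is the trace
    [z |-> sum_j z^(q^j)] of a finite residue field; this polynomial has too small a degree to vanish
    identically, so [p] does not divide the discriminant.  Conversely, if the discriminant is prime
    to [p] then [OL/pOL] is reduced, because nilpotents have trace zero, and [a^N = a] can be checked
    in the residue fields, where it holds exactly when [N(p)^f - 1] divides [N - 1]. *)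

(** * Subrings and ideals *)

(** The obstacle is that [OL] need not be free over [OK], so the size of [OL/nOL] cannot be read off
    a global basis. Localisation is expressed by denominators: a relation at [p] holds after
    multiplication by some [s] outside [p], and [s] is invertible modulo [p]. Square-freeness enters
    as an element [u] outside [p] with [u p] contained in [n], which is how [n] looks like [p] near
    [p]. The exponent [N(n)^d] of the third condition is simply the size of [OL/nOL]; it is the same
    whether or not [n] ramifies, so it can be computed before the discriminant is considered. *)

Section SubringTheory.
Variables (R : comNzRingType) (S : R -> Prop).
Hypothesis sS : subring S.

Lemma subring0 : S 0. Proof. by case: sS. Qed.
Lemma subring1 : S 1. Proof. by case: sS. Qed.
Lemma subringB x y : S x -> S y -> S (x - y). Proof. by case: sS => _ _ H _; apply: H. Qed.
Lemma subringM x y : S x -> S y -> S (x * y). Proof. by case: sS => _ _ _; apply. Qed.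
Lemma subringN x : S x -> S (- x).
Proof. by move=> Sx; rewrite -sub0r; apply: subringB => //; apply: subring0. Qed.
Lemma subringD x y : S x -> S y -> S (x + y).
Proof. by move=> Sx Sy; rewrite -[y]opprK; apply: subringB => //; apply: subringN. Qed.
Lemma subringX x m : S x -> S (x ^+ m).
Proof.
move=> Sx; elim: m => [|m IH]; first by rewrite expr0; apply: subring1.
by rewrite exprS; apply: subringM.
Qed.
Lemma subring_sum (J : Type) (r : seq J) (Q : pred J) (F : J -> R) :
  (forall i, Q i -> S (F i)) -> S (\sum_(i <- r | Q i) F i).
Proof. by move=> SF; apply: (big_ind S) => //; [apply: subring0 | apply: subringD]. Qed.
Lemma subring_prod (J : Type) (r : seq J) (Q : pred J) (F : J -> R) :
  (forall i, Q i -> S (F i)) -> S (\prod_(i <- r | Q i) F i).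
Proof. by move=> SF; apply: (big_ind S) => //; [apply: subring1 | apply: subringM]. Qed.
Lemma subring_det m (A : 'M[R]_m) : (forall i j, S (A i j)) -> S (\det A).
Proof.
move=> SA; apply: subring_sum => s _; apply: subringM; last exact: subring_prod.
by apply: subringX; apply: subringN; apply: subring1.
Qed.
Lemma subring_adj m (A : 'M[R]_m) : (forall i j, S (A i j)) -> forall i j, S ((\adj A) i j).
Proof.
move=> SA i j; rewrite mxE; apply: subringM.
  by apply: subringX; apply: subringN; apply: subring1.
by apply: subring_det => k l; rewrite !mxE.
Qed.

Section Ideal.
Variable I : R -> Prop.
Hypothesis iI : ideal_of S I.

Lemma ideal_sub x : I x -> S x. Proof. by case: iI => H *; apply: H. Qed.
Lemma ideal0 : I 0. Proof. by case: iI. Qed.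
Lemma idealD x y : I x -> I y -> I (x + y). Proof. by case: iI => _ _ H _; apply: H. Qed.
Lemma idealMl r x : S r -> I x -> I (r * x). Proof. by case: iI => _ _ _; apply. Qed.
Lemma ideal_mulr r x : S r -> I x -> I (x * r).
Proof. by rewrite mulrC; apply: idealMl. Qed.
Lemma idealN x : I x -> I (- x).
Proof. by rewrite -mulN1r; apply: idealMl; apply: subringN; apply: subring1. Qed.
Lemma idealB x y : I x -> I y -> I (x - y).
Proof. by move=> Ix Iy; apply: idealD => //; apply: idealN. Qed.
Lemma ideal_sum (J : Type) (r : seq J) (Q : pred J) (F : J -> R) :
  (forall i, Q i -> I (F i)) -> I (\sum_(i <- r | Q i) F i).
Proof. by move=> SF; apply: (big_ind I) => //; [apply: ideal0 | apply: idealD]. Qed.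
Lemma ideal_subC x y : I (x - y) -> I (y - x).
Proof. by move/idealN; rewrite opprB. Qed.
Lemma ideal_trans y x z : I (x - y) -> I (y - z) -> I (x - z).
Proof. by move=> a b; rewrite -(subrKA y); apply: idealD. Qed.
Lemma ideal_congr x y : I (x - y) -> I y -> I x.
Proof. by move=> a b; rewrite -[x](subrK y); apply: idealD. Qed.
Lemma ideal1 x : I 1 -> S x -> I x.
Proof. by move=> I1 Sx; rewrite -[x]mulr1; apply: idealMl. Qed.
Lemma ideal_subM a b c d : S a -> S d -> I (a - b) -> I (c - d) -> I (a * c - b * d).
Proof.
move=> Sa Sd Iab Icd; have ->: a * c - b * d = a * (c - d) + (a - b) * d by ring.
by apply: idealD; [apply: idealMl | apply: ideal_mulr].
Qed.
End Ideal.

Lemma gen_ideal_ind (G Q : R -> Prop) :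
  Q 0 -> (forall x y, Q x -> Q y -> Q (x + y)) ->
  (forall r g, S r -> G g -> Q (r * g)) ->
  forall y, gen_ideal S G y -> Q y.
Proof.
move=> Q0 QD QG y [s [sP ->]]; rewrite big_seq.
by apply: (big_ind Q) => // q /sP[]; apply: QG.
Qed.

Lemma gen_idealM (G : R -> Prop) r g : S r -> G g -> gen_ideal S G (r * g).
Proof.
move=> Sr Gg; exists [:: (r, g)]; split; last by rewrite big_seq1.
by move=> q; rewrite inE => /eqP->.
Qed.

Lemma gen_ideal_incl (G : R -> Prop) g : G g -> gen_ideal S G g.
Proof. by move=> Gg; rewrite -[g]mul1r; apply: gen_idealM => //; apply: subring1. Qed.

Lemma gen_ideal_ideal (G : R -> Prop) : (forall g, G g -> S g) -> ideal_of S (gen_ideal S G).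
Proof.
move=> GS.
have g0 : gen_ideal S G 0 by exists [::]; rewrite big_nil.
have gD x y : gen_ideal S G x -> gen_ideal S G y -> gen_ideal S G (x + y).
  move=> [s [sP ->]] [t [tP ->]]; exists (s ++ t); rewrite big_cat; split=> // q.
  by rewrite mem_cat => /orP[/sP|/tP].
split=> //.
  apply: gen_ideal_ind; [exact: subring0 | exact: subringD |].
  by move=> r g Sr /GS; apply: subringM.
move=> r x Sr; move: x; apply: gen_ideal_ind.
- by rewrite mulr0.
- by move=> x y; rewrite mulrDr; apply: gD.
- by move=> r' g Sr' Gg; rewrite mulrA; apply: gen_idealM => //; apply: subringM.
Qed.

Lemma ideal_addition I J : ideal_of S I -> ideal_of S J ->
  ideal_of S (fun x => exists a b, [/\ I a, J b & x = a + b]).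
Proof.
move=> iI iJ; split.
- by move=> _ [a [b [Ia Jb ->]]]; apply: subringD; [apply: ideal_sub Ia|apply: ideal_sub Jb].
- by exists 0, 0; rewrite addr0; split=> //; [apply: ideal0 iI|apply: ideal0 iJ].
- move=> _ _ [a [b [Ia Jb ->]]] [a' [b' [Ia' Jb' ->]]].
  exists (a + a'), (b + b'); rewrite addrACA; split=> //; first exact: idealD Ia Ia'.
  exact: idealD Jb Jb'.
- move=> r _ Sr [a [b [Ia Jb ->]]]; exists (r * a), (r * b); rewrite mulrDr.
  by split=> //; [apply: idealMl Ia|apply: idealMl Jb].
Qed.

(** Maximality is applied to [I + M], which is not contained in [M]. *)
Lemma maximal_coprime M I : maximal_ideal S M -> ideal_of S I ->
  (exists2 u, I u & ~ M u) -> exists a b, [/\ I a, M b & a + b = 1].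
Proof.
move=> [[iM M1] maxM] iI [u Iu Mu].
have [JM | [a [b [Ia Mb e]]]] :=
  maxM _ (ideal_addition iI iM) (fun x Mx => ex_intro _ 0 (ex_intro _ x
    (And3 (ideal0 iI) Mx (esym (add0r x))))); last by exists a, b.
by case: Mu; apply: JM; exists u, 0; rewrite addr0; split=> //; apply: ideal0 iM.
Qed.

(** The colon ideal [(I : Q)]. With [Q] a prime above [I] it is the larger ideal of the Noetherian
    induction in [ext_ideal_residue]. *)
Lemma ideal_colon (Q I : R -> Prop) : ideal_of S I ->
  ideal_of S (fun x => S x /\ forall q, Q q -> I (x * q)).
Proof.
move=> iI; split.
- by move=> x [].
- split=> [|q _]; [exact: subring0 | rewrite mul0r; exact: ideal0 iI].
- move=> x y [Sx Ix] [Sy Iy]; split=> [|q Qq]; first exact: subringD.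
  by rewrite mulrDl; apply: (idealD iI); [apply: Ix | apply: Iy].
- move=> r x Sr [Sx Ix]; split=> [|q Qq]; first exact: subringM.
  by rewrite -mulrA; apply: (idealMl iI) => //; apply: Ix.
Qed.

Lemma maximal_inv M x : maximal_ideal S M -> S x -> ~ M x ->
  exists2 y, S y & M (x * y - 1).
Proof.
move=> mM Sx Mx; have [[iM _] _] := mM.
have ix : ideal_of S (fun z => exists2 y, S y & z = x * y).
  split.
  - by move=> _ [y Sy ->]; apply: subringM.
  - by exists 0; [apply: subring0 | rewrite mulr0].
  - by move=> _ _ [y Sy ->] [z Sz ->]; exists (y + z); [apply: subringD | rewrite mulrDr].
  - by move=> r _ Sr [y Sy ->]; exists (r * y); [apply: subringM | rewrite mulrCA].
have [|_ [b [[y Sy ->] Mb e]]] := maximal_coprime mM ix.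
  by exists x => //; exists 1; [apply: subring1 | rewrite mulr1].
by exists y => //; rewrite -e opprD addNKr; apply: (idealN iM).
Qed.

Lemma maximal_prime M : maximal_ideal S M -> prime_ideal S M.
Proof.
move=> mM; have [pM _] := mM; split=> // x y Sx Sy Mxy.
have [iM _] := pM.
have [?|Mx] := pselect (M x); [by left | right].
have [z Sz Mz] := maximal_inv mM Sx Mx.
have -> : y = z * (x * y) - y * (x * z - 1) by ring.
by apply: (idealB iM); apply: (idealMl iM).
Qed.

Lemma prime_nX P x m : prime_ideal S P -> S x -> P (x ^+ m) -> P x.
Proof.
move=> [[iP P1] pP] Sx; elim: m => [|m IH]; first by rewrite expr0.
by rewrite exprS => /pP[] //; apply: subringX.
Qed.

Hypothesis nS : noetherian S.

Lemma noetherian_chain (I : nat -> R -> Prop) :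
  (forall k, ideal_of S (I k)) -> (forall k x, I k x -> I k.+1 x) ->
  exists m, forall x, I m.+1 x -> I m x.
Proof.
move=> iI Iinc.
have Imono k l x : (k <= l)%N -> I k x -> I l x.
  move=> /subnK <-; elim: (l - k)%N => [|j IH] //=.
  by move=> /IH; rewrite addSn; apply: Iinc.
have iU : ideal_of S (fun x => exists k, I k x).
  split.
  - by move=> x [k]; apply: (ideal_sub (iI k)).
  - by exists 0%N; apply: ideal0 (iI _).
  - move=> x y [k Ix] [l Iy]; exists (maxn k l); apply: (idealD (iI _)).
      by apply: Imono Ix; apply: leq_maxl.
    by apply: Imono Iy; apply: leq_maxr.
  - by move=> r x Sr [k Ix]; exists k; apply: (idealMl (iI k)).
have [s sP] := nS iU.
suff [m mP] : exists m, forall g, g \in s -> I m g.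
  exists m => x Ix; have /sP : exists k, I k x by exists m.+1.
  apply: gen_ideal_ind; [exact: ideal0 (iI m) | exact: (idealD (iI m)) |].
  by move=> r g Sr gs; apply: (idealMl (iI m)) => //; apply: mP.
have : forall g, g \in s -> exists k, I k g.
  by move=> g gs; apply/sP; apply: gen_ideal_incl.
elim: s {sP} => [|h s IH] hs; first by exists 0%N.
have [m mP] := IH (fun g gs => hs g (@mem_behead _ (h :: s) g gs)).
have [k kP] := hs h (mem_head _ _).
exists (maxn k m) => g; rewrite inE => /orP[/eqP->|/mP].
  by move: kP; apply: Imono; apply: leq_maxl.
by apply: Imono; apply: leq_maxr.
Qed.

Lemma noetherian_ind (Q : (R -> Prop) -> Prop) :
  (forall I, ideal_of S I ->
     (forall J, ideal_of S J -> (forall x, I x -> J x) -> (exists2 x, J x & ~ I x) -> Q J) ->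
     Q I) ->
  forall I, ideal_of S I -> Q I.
Proof.
move=> QI I iI; apply: contrapT => nQ.
pose T := {J : R -> Prop | ideal_of S J /\ ~ Q J}.
have step (J : T) : {J' : T | (forall x, sval J x -> sval J' x) /\
                              exists2 x, sval J' x & ~ sval J x}.
  apply: cid; case: J => J [iJ nQJ] /=; apply: contrapT => nJ.
  apply: nQJ; apply: QI => // J' iJ' sub neq; apply: contrapT => nQJ'.
  by apply: nJ; exists (exist _ J' (conj iJ' nQJ')).
(* If [Q] fails at [I], every failing ideal has a strictly larger failing one; iterating the choice
   contradicts the chain condition. *)
pose c := fix c k : T := if k is j.+1 then sval (step (c j)) else exist _ I (conj iI nQ).
have [||m mP] := @noetherian_chain (fun k => sval (c k)).
- by move=> k; case: (svalP (c k)).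
- by move=> k x; case: (svalP (step (c k))) => H _; apply: H.
by case: (svalP (step (c m))) => _ [x] /mP.
Qed.

Lemma noetherian_max (Q : (R -> Prop) -> Prop) I0 : ideal_of S I0 -> Q I0 ->
  exists I, [/\ ideal_of S I, Q I & forall J, ideal_of S J -> Q J ->
     (forall x, I x -> J x) -> forall x, J x -> I x].
Proof.
move=> iI0; move: I0 iI0; apply: noetherian_ind => I iI IH QI.
have [[J [iJ QJ IJ nJI]]|nJ] := pselect (exists J, [/\ ideal_of S J, Q J,
    forall x, I x -> J x & exists2 x, J x & ~ I x]); first exact: IH J iJ IJ nJI QJ.
exists I; split=> // J iJ QJ IJ x Jx; apply: contrapT => nIx; apply: nJ.
by exists J; split=> //; exists x.
Qed.

Lemma exists_maximal I : ideal_of S I -> ~ I 1 ->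
  exists2 M, maximal_ideal S M & forall x, I x -> M x.
Proof.
move=> iI I1.
have [|M [iM [M1 IM] maxM]] := @noetherian_max (fun J => ~ J 1 /\ forall x, I x -> J x) I iI.
  by split.
exists M => //; split; first by split.
move=> J iJ MJ; have [J1|J1] := pselect (J 1); [by right | left].
by apply: maxM => //; split=> // x /IM; apply: MJ.
Qed.

End SubringTheory.

(** * Dedekind domains *)

Section Dedekind.
Variables (K : fieldType) (OK : K -> Prop).
Hypothesis dK : dedekind OK.

Lemma ded_subring : subring OK. Proof. by case: dK. Qed.
Lemma ded_noetherian : noetherian OK. Proof. by case: dK. Qed.
Let sO := ded_subring.

Lemma ded_maximal P : prime_ideal OK P -> nonzero_ideal P -> maximal_ideal OK P.
Proof. by case: dK => _ _ _ _; apply. Qed.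

Lemma ded_integral (x : K) m (c : 'I_m -> K) : (forall i, OK (c i)) ->
  x ^+ m = \sum_(i < m) c i * x ^+ i -> OK x.
Proof.
move=> Oc xm; case: dK => _ _ _ H _; apply: H.
(* [oapp c 0 (insub i)] extends [c] from ['I_m] to all indices by [0]. *)
pose q : {poly K} := \poly_(i < m) oapp c 0 (insub i).
have sq : (size q < size ('X^m : {poly K})%R)%N by rewrite size_polyXn ltnS size_poly.
exists ('X^m - q); split.
- by rewrite monicE lead_coefDl ?lead_coefXn // size_polyN.
- move=> i; rewrite coefB coefXn coef_poly; apply: subringB => //.
    by case: eqP => _; [apply: subring1 | apply: subring0].
  by case: ifP => [lt|_]; [rewrite insubT /= | apply: subring0].
- have -> : map_poly (in_alg K^o) ('X^m - q) = 'X^m - q.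
    by rewrite map_poly_id // => y _; rewrite /= /GRing.scale /= mulr1.
  rewrite hornerD hornerN hornerXn horner_poly; apply/eqP; rewrite subr_eq0.
  apply/eqP; rewrite [LHS]xm; apply: eq_bigr => i _.
  by rewrite insubT //= => lt; congr (c _ * _); apply: val_inj.
Qed.

Lemma ded_frac (x : K) : exists2 b, OK b /\ b != 0 & OK (b * x).
Proof.
case: dK => _ /(_ x)[a [b [Oa Ob b0 ->]]] _ _ _.
by exists b => //; rewrite mulrC divfK.
Qed.

Lemma ded_frac_fin (J : finType) (x : J -> K) :
  exists2 b, OK b /\ b != 0 & forall i, OK (b * x i).
Proof.
have /choice[b bP] : forall i, exists b, [/\ OK b, b != 0 & OK (b * x i)].
  by move=> i; have [b [? ?] ?] := ded_frac (x i); exists b.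
exists (\prod_i b i).
  split; first by apply: subring_prod => // i _; case: (bP i).
  by apply/prodf_neq0 => i _; case: (bP i).
move=> i; rewrite (bigD1 i) //= mulrAC; apply: subringM => //; first by case: (bP i).
by apply: subring_prod => // j _; case: (bP j).
Qed.

Lemma ded_sqrt x : OK (x ^+ 2) -> OK x.
Proof.
move=> Ox; apply: (@ded_integral x 2 (fun i => if i == 0%R then x ^+ 2 else 0)).
  by move=> i; case: ifP => // _; apply: subring0.
by rewrite big_ord_recl big_ord1 /= expr0 mulr1 mul0r addr0.
Qed.

(* The ideals generated by [x, x pi, ..., x pi^m] stabilise. *)
Lemma ded_power_bounded (x pi : K) : x != 0 -> (forall k, OK (x * pi ^+ k)) -> OK pi.
Proof.
move=> x0 Ox.
pose I m (y : K) := exists c : nat -> K,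
  (forall i, OK (c i)) /\ y = \sum_(i < m) c i * (x * pi ^+ i).
have iI m : ideal_of OK (I m).
  split.
  - by move=> _ [c [Oc ->]]; apply: subring_sum => // i _; apply: subringM.
  - exists (fun=> 0); split=> [_|]; first exact: subring0.
    by rewrite big1 // => i _; rewrite mul0r.
  - move=> _ _ [c [Oc ->]] [c' [Oc' ->]]; exists (fun i => c i + c' i).
    split=> [i|]; first exact: subringD.
    by rewrite -big_split; apply: eq_bigr => i _; rewrite mulrDl.
  - move=> r _ Or [c [Oc ->]]; exists (fun i => r * c i).
    split=> [i|]; first exact: subringM.
    by rewrite mulr_sumr; apply: eq_bigr => i _; rewrite -mulrA.
have [|m mP] := noetherian_chain sO ded_noetherian iI.
  move=> m _ [c [Oc ->]]; exists (fun i => if (i < m)%N then c i else 0).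
  split=> [i|]; first by case: ifP => // _; apply: subring0.
  rewrite big_ord_recr /= ltnn mul0r addr0.
  by apply: eq_bigr => i _; rewrite ltn_ord.
have /mP[c [Oc e]] : I m.+1 (x * pi ^+ m).
  exists (fun i => if i == m then 1 else 0); split=> [i|].
    by case: ifP => _; [apply: subring1 | apply: subring0].
  rewrite big_ord_recr /= eqxx mul1r big1 ?add0r // => i _.
  by rewrite ltn_eqF ?mul0r.
apply: (@ded_integral pi m (fun i => c i)) => //.
apply: (mulfI x0); rewrite e mulr_sumr; apply: eq_bigr => i _.
by rewrite mulrCA.
Qed.

Section Prime.
Variable p : K -> Prop.
Hypotheses (pp : prime_ideal OK p) (p0 : nonzero_ideal p).
Let mp : maximal_ideal OK p := ded_maximal pp p0.
Let ip : ideal_of OK p. Proof. by case: pp => [[]]. Qed.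

(* A maximal conductor [(a) : b] contained in [p] is a prime ideal, hence equals [p]; then [b / a]
   lies in the inverse of [p] but not in [OK]. *)
Lemma ded_inverse : exists2 pi, (forall x, p x -> OK (pi * x)) & exists2 x, p x & ~ p (pi * x).
Proof.
have [a [pa a0]] := p0.
pose q b x := OK x /\ OK (x * b / a).
have iq b : OK b -> ideal_of OK (q b).
  move=> Ob; split.
  - by move=> x [].
  - by split; rewrite ?mul0r; apply: subring0.
  - by move=> x y [Ox Oxb] [Oy Oyb]; split; rewrite ?mulrDl; apply: subringD.
  - by move=> r x Or [Ox Oxb]; split; rewrite -?mulrA; apply: subringM => //; rewrite mulrA.
(* The family of conductors inside [p] is nonempty: [q 1] is the principal ideal [(a)]. *)
pose Q I := exists b, [/\ OK b, (forall x, I x <-> q b x) & forall x, q b x -> p x].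
have [||I [iI [b [Ob Ib qp]] maxq]] := @noetherian_max _ _ sO ded_noetherian Q (q 1).
- exact: iq (subring1 sO).
- exists 1; split=> // [|x [Ox]]; first exact: subring1.
  by rewrite mulr1 => Oxa; rewrite -[x](divfK a0); apply: (idealMl ip).
have {maxq} maxq b' : OK b' -> (forall x, q b' x -> p x) -> (forall x, q b x -> q b' x) ->
    forall x, q b' x -> q b x.
  move=> Ob' q'p qq' x q'x; apply/Ib; apply: maxq q'x; [exact: iq | by exists b' |].
  by move=> y /Ib /qq'.
have pq : prime_ideal OK (q b).
  split; first by split; [apply: iq | move/qp; case: pp => [[]]].
  move=> x y Ox Oy [_ Oxy].
  have [qx|qx] := pselect (q b x); [by left | right].
  (* If [q (b * x)] lies in [p], it equals [q b] by maximality, and it contains [y]. Otherwise some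
     [t] outside [p] lies in it; then [q (b * t)] lies in [p] because [p] is prime, so it equals
     [q b], and it contains [x]. *)
  have [H|H] := pselect (forall t, q (b * x) t -> p t).
    apply: (maxq (b * x)) => //; first exact: subringM.
      by move=> z [Oz Ozb]; split=> //; rewrite [_ / a](_ : _ = z * b / a * x); [apply: subringM | ring].
    by split=> //; move: Oxy; congr OK; ring.
  move/existsNP: H => [t /not_implyP[[Ot Otx] pt]].
  case: qx; apply: (maxq (b * t)) => //; first exact: subringM.
  - move=> z [Oz Ozb]; have : p (z * t).
      apply: qp; split; first exact: subringM.
      by move: Ozb; congr OK; ring.
    by case: pp => _ H /H[].
  - by move=> z [Oz Ozb]; split=> //; rewrite [_ / a](_ : _ = z * b / a * t); [apply: subringM | ring].
  - by split=> //; move: Otx; congr OK; ring.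
have mq : maximal_ideal OK (q b).
  apply: ded_maximal => //; exists a; split=> //; split; first exact: (ideal_sub ip).
  by rewrite mulrAC divff // mul1r.
have pq' x : p x -> q b x.
  move=> px; case: mq => _ /(_ p ip qp)[|p1]; first exact.
  by case: pp => [[]].
have Opi x : p x -> OK (b / a * x).
  by move=> /pq'[_]; congr OK; ring.
(* If [b / a] mapped [p] into itself, all [a (b / a)^k] would lie in [p], so [b / a] would be in
   [OK] and [1] in [q b]. *)
exists (b / a) => //; apply: contrapT => H.
have {}H x : p x -> p (b / a * x) by move=> px; apply: contrapT => nx; apply: H; exists x.
have /qp : q b 1; last by case: pp => [[]].
split; first exact: subring1.
rewrite mul1r; apply: (ded_power_bounded a0) => k; apply: (ideal_sub ip).
elim: k => [|k IH]; first by rewrite expr0 mulr1.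
by rewrite exprS mulrCA; apply: H.
Qed.

(** [t] is a power of the [pi] of [ded_inverse], in effect a uniformizer to minus the least
    valuation on [I]. If multiplying by [pi] never led out of [p], all [pi^k x] would be integral,
    which forces [pi] into [OK]. *)
Lemma ded_scaling (I : K -> Prop) : (forall x, I x -> OK x) -> (exists2 x, I x & x != 0) ->
  exists2 t, (forall x, I x -> OK (t * x)) & exists2 x, I x & ~ p (t * x).
Proof.
move=> IO [x0 Ix0 nz]; have [pi Opi [z pz npz]] := ded_inverse.
apply: contrapT => H.
have Hk k : forall x, I x -> OK (pi ^+ k * x).
  elim: k => [|k IH] x Ix; first by rewrite expr0 mul1r; apply: IO.
  rewrite exprS -mulrA; apply: Opi; apply: contrapT => npx; apply: H.
  by exists (pi ^+ k) => //; exists x.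
suff Opi1 : OK pi by apply: npz; apply: (idealMl ip).
by apply: (ded_power_bounded nz) => k; rewrite mulrC; apply: Hk.
Qed.

(* If [pi p] is contained in [OK] but not in [p], and [x] is in [n] but not in [p^2], then
   [u := pi x] works. *)
Lemma square_free_colon n : ideal_of OK n -> square_free OK n -> (forall x, n x -> p x) ->
  exists u, [/\ OK u, ~ p u & forall x, p x -> n (u * x)].
Proof.
move=> iN [_ /(_ p pp p0) nsq] np; have [pi Opi [z pz npz]] := ded_inverse.
have [x nx npx] : exists2 x, n x & ~ p (pi * x).
  apply: contrapT => H; apply: nsq => x nx.
  have ppx : p (pi * x) by apply: contrapT => npx; apply: H; exists x.
  have [v Ov pv] := maximal_inv sO mp (Opi z pz) npz.
  have i2 : ideal_of OK (prod_ideal OK p p).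
    apply: (gen_ideal_ideal sO) => _ [a [b [pa [pb ->]]]].
    by apply: subringM => //; apply: (ideal_sub ip).
  (* [v] inverts [pi * z] modulo [p], so both terms are products of two elements of [p]. *)
  have -> : x = pi * x * (v * z) - (pi * z * v - 1) * x by ring.
  apply: (idealB sO i2); apply: (gen_ideal_incl sO).
    by exists (pi * x), (v * z); do 2!split=> //; apply: (idealMl ip).
  by exists (pi * z * v - 1), x; split=> //; split=> //; apply: np.
exists (pi * x); split=> [||y py]; [exact: Opi (np _ nx) | by [] |].
by rewrite mulrAC; apply: (idealMl iN) => //; apply: Opi.
Qed.
End Prime.

(** The denominators of [x] form a nonzero ideal; by hypothesis no maximal ideal contains it, so it
    contains [1]. *)
Lemma ded_local_global x :
  (forall p, prime_ideal OK p -> nonzero_ideal p -> exists s, [/\ OK s, ~ p s & OK (s * x)]) ->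
  OK x.
Proof.
move=> loc; have iI : ideal_of OK (fun s => OK s /\ OK (s * x)).
  split.
  - by move=> s [].
  - by rewrite mul0r; split; apply: subring0.
  - by move=> s t [? ?] [? ?]; rewrite mulrDl; split; apply: subringD.
  - by move=> r s ? [? ?]; rewrite -mulrA; split; apply: subringM.
have [[_]|n1] := pselect (OK 1 /\ OK (1 * x)); first by rewrite mul1r.
have [M mM sub] := exists_maximal sO ded_noetherian iI n1.
have [||s [Os nMs Osx]] := loc M; first exact: maximal_prime.
  by have [b [Ob b0] Obx] := ded_frac x; exists b; split=> //; apply: sub.
by case: nMs; apply: sub.
Qed.

End Dedekind.

(** * The integral closure is a ring *)

Section IntegralClosure.
Variables (K : fieldType) (OK : K -> Prop) (sO : subring OK).

(** The proof is an argument so that closure under the ring operations can be declared for this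
    predicate; [OK] then becomes a packed ring, to which the general theory of [integralOver]
    applies. *)
Definition subring_pred of subring OK : {pred K} := fun x => `[< OK x >].
Local Notation O := (subring_pred sO).

Fact subring_pred_closed : subring_closed O.
Proof.
split; first by apply/asboolP; apply: subring1.
  by move=> x y /asboolP Ox /asboolP Oy; apply/asboolP; apply: subringB.
by move=> x y /asboolP Ox /asboolP Oy; apply/asboolP; apply: subringM.
Qed.
HB.instance Definition _ := GRing.isSubringClosed.Build K O subring_pred_closed.

Record subring_type := SubringType { subring_val :> K; _ : subring_val \in O }.
HB.instance Definition _ := [isSub for subring_val].
HB.instance Definition _ := [Choice of subring_type by <:].
HB.instance Definition _ := [SubChoice_isSubComNzRing of subring_type by <:].

Variable L : fieldExtType K.

Lemma intclos_integralOver (y : L) :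
  intclos OK y <-> integralOver (in_alg L \o (val : subring_type -> K)) y.
Proof.
split=> [[p [mp Op py]] | [q mq qy]].
  pose q : {poly subring_type} := \poly_(i < size p) insubd (0 : subring_type) p`_i.
  have qp : map_poly val q = p.
    apply/polyP => i; rewrite coef_map coef_poly; case: ltnP => [lt|le].
      by apply: insubdK; apply/asboolP; apply: Op.
    by rewrite nth_default // raddf0.
  exists q; last by rewrite map_poly_comp qp; apply/eqP.
  apply/eqP/val_inj; rewrite -(lead_coef_map_inj val_inj (rmorph0 _)) qp.
  exact: (monicP mp).
exists (map_poly val q); split.
- exact: monic_map.
- by move=> i; rewrite coef_map; have /asboolP := valP q`_i.
- by rewrite -map_poly_comp; apply/eqP.
Qed.

Lemma intclos_subring : subring (@intclos K L OK).
Proof.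
split.
- by apply/intclos_integralOver; apply: integral0.
- by apply/intclos_integralOver; apply: integral1.
- by move=> x y /intclos_integralOver ix /intclos_integralOver iy;
  apply/intclos_integralOver; apply: integral_sub.
- by move=> x y /intclos_integralOver ix /intclos_integralOver iy;
  apply/intclos_integralOver; apply: integral_mul.
Qed.

Lemma intclos_alg a : OK a -> @intclos K L OK a%:A.
Proof.
move=> Oa; have aO : a \in O by apply/asboolP.
by apply/intclos_integralOver; apply: (integral_id _ (SubringType aO)).
Qed.

Lemma intclosZ a (y : L) : OK a -> intclos OK y -> intclos OK (a *: y).
Proof.
move=> Oa Oy; rewrite -mulr_algl; apply: subringM => //; first exact: intclos_subring.
exact: intclos_alg.
Qed.
End IntegralClosure.

(** * Multiplication matrices and the trace *)

Section Coordinates.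
Variables (K : fieldType) (L : fieldExtType K).
Local Notation d := (\dim {:L}).
Local Notation b := (vbasis {:L}).
Implicit Types (y z : L) (e : 'I_d -> L).

(** Coordinates are rows and matrices act on the right, hence the reversed order in [mulLM]. *)
Definition rowL y : 'rV[K]_d := \row_j coord b j y.
Definition famL m (e : 'I_m -> L) : 'M[K]_(m, d) := \matrix_(i, j) coord b j (e i).
Definition mulL y : 'M[K]_d := famL (fun i => y * tnth b i).

Lemma rowL_sum y : y = \sum_i rowL y 0 i *: tnth b i.
Proof.
rewrite {1}(coord_vbasis (memvf y)); apply: eq_bigr => i _.
by rewrite mxE (tnth_nth 0).
Qed.

Lemma rowL_inj : injective rowL.
Proof. by move=> y z e; rewrite (rowL_sum y) e -rowL_sum. Qed.

Lemma rowL_is_linear : linear rowL.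
Proof. by move=> a y z; apply/rowP => j; rewrite !mxE linearP. Qed.
HB.instance Definition _ := GRing.isLinear.Build K L _ _ rowL rowL_is_linear.

Lemma row_famL m (e : 'I_m -> L) i : row i (famL e) = rowL (e i).
Proof. by apply/rowP => j; rewrite !mxE. Qed.

Lemma famL_mul m k (e : 'I_m -> L) (f : 'I_k -> L) (C : 'M[K]_(m, k)) :
  famL e = C *m famL f <-> forall i, e i = \sum_j C i j *: f j.
Proof.
have rs i : rowL (\sum_j C i j *: f j) = row i (C *m famL f).
  rewrite linear_sum row_mul mulmx_sum_row; apply: eq_bigr => j _.
  by rewrite linearZ row_famL mxE.
split=> [E i|E].
  by apply: rowL_inj; rewrite rs -E row_famL.
by apply/row_matrixP => i; rewrite -rs -E row_famL.
Qed.

Lemma rowL_mul y z : rowL (y * z) = rowL z *m mulL y.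
Proof.
rewrite [in LHS](rowL_sum z) mulr_sumr linear_sum mulmx_sum_row; apply: eq_bigr => i _.
by rewrite -scalerAr linearZ row_famL.
Qed.

Lemma famL_mulL y m (e : 'I_m -> L) : famL (fun i => y * e i) = famL e *m mulL y.
Proof. by apply/row_matrixP => i; rewrite row_mul !row_famL rowL_mul. Qed.

Lemma famL_vbasis : famL (fun i => tnth b i) = 1%:M.
Proof.
apply/matrixP => i j; rewrite [LHS]mxE [RHS]mxE (tnth_nth 0).
by rewrite (coord_free _ _ (basis_free (vbasisP _))) eq_sym.
Qed.

Lemma mulLM y z : mulL (y * z) = mulL z *m mulL y.
Proof. by rewrite -famL_mulL; congr famL; apply: funext => i; rewrite mulrA. Qed.

Lemma mulL_is_linear : linear mulL.
Proof. by move=> a y z; apply/matrixP => i j; rewrite !mxE mulrDl -scalerAl linearP. Qed.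
HB.instance Definition _ := GRing.isLinear.Build K L _ _ mulL mulL_is_linear.

Lemma mulL1 : mulL 1 = 1%:M.
Proof. by rewrite -famL_vbasis; congr famL; apply: funext => i; rewrite mul1r. Qed.

Lemma trLKE y : trLK y = \tr (mulL y).
Proof. by rewrite /trLK /mxtrace; apply: eq_bigr => i _; rewrite mxE. Qed.

Lemma trLKZ a y : trLK (a *: y) = a * trLK y.
Proof. by rewrite !trLKE linearZ mxtraceZ. Qed.

Lemma trLK_sum (I : finType) (c : I -> K) (f : I -> L) :
  trLK (\sum_i c i *: f i) = \sum_i c i * trLK (f i).
Proof.
rewrite trLKE linear_sum raddf_sum; apply: eq_bigr => i _.
by rewrite /= -trLKE trLKZ.
Qed.

(** [C] and [mulL y] are conjugate by [famL e]. *)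
Lemma trLK_frame e y (C : 'M[K]_d) : \det (famL e) != 0 ->
  (forall i, y * e i = \sum_j C i j *: e j) -> trLK y = \tr C.
Proof.
move=> det0 /famL_mul; rewrite famL_mulL => E; rewrite trLKE.
have uE : famL e \in unitmx by rewrite unitmxE unitfE.
by rewrite -[C](mulmxK uE) -E mxtrace_mulC mulmxA mulVmx // mul1mx.
Qed.

Lemma disc_famL e : disc_elt e = \det (famL e) ^+ 2 * disc_elt (fun i => tnth b i).
Proof.
rewrite /disc_elt.
have -> : (\matrix_(i, j) trLK (e i * e j))
  = famL e *m (\matrix_(i, j) trLK (tnth b i * tnth b j)) *m (famL e)^T.
  apply/matrixP => i j; rewrite !mxE.
  rewrite [in LHS](rowL_sum (e j)) mulr_sumr.
  under eq_bigr do rewrite -scalerAr; rewrite trLK_sum; apply: eq_bigr => l _.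
  rewrite !mxE [LHS]mulrC; congr (_ * _); rewrite [in LHS](rowL_sum (e i)) mulr_suml.
  under eq_bigr do rewrite -scalerAl; rewrite trLK_sum; apply: eq_bigr => k _.
  by rewrite !mxE.
by rewrite !det_mulmx det_tr; ring.
Qed.

(** Cramer's rule in the division-free form [y adj(E) E = det(E) y], with [E] the matrix of [e]. *)
Lemma cramer_famL e y : \sum_i \det (famL (fun k => if k == i then y else e k)) *: e i
  = \det (famL e) *: y.
Proof.
apply: rowL_inj; rewrite linear_sum linearZ /= -mul_mx_scalar -mul_adj_mx mulmxA mulmx_sum_row.
apply: eq_bigr => i _; rewrite linearZ row_famL; congr (_ *: _).
rewrite (expand_det_row _ i) mxE; apply: eq_bigr => j _.
rewrite !mxE eqxx; congr (_ * _); rewrite /cofactor; congr (_ * \det _).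
by apply/matrixP => k l; rewrite !mxE eq_sym (negbTE (neq_lift _ _)).
Qed.

Section Frame.
Variables (OK : K -> Prop) (dK : dedekind OK).

(* Among all families in [M], choose one whose determinant has minimal valuation at [p]; by Cramer's
   rule it is a basis of [M] after localisation at [p]. *)
Lemma local_basis (M : L -> Prop) (p : K -> Prop) t0 :
  prime_ideal OK p -> nonzero_ideal p -> t0 != 0 ->
  (forall e, (forall i, M (e i)) -> OK (t0 * \det (famL e))) ->
  (exists2 e, forall i, M (e i) & \det (famL e) != 0) ->
  exists e s, [/\ forall i, M (e i), \det (famL e) != 0, OK s, ~ p s &
    forall y, M y -> exists c : 'I_d -> K, (forall i, OK (c i)) /\ s *: y = \sum_i c i *: e i].
Proof.
move=> pp p0 t00 OM [e0 Me0 de0].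
pose I x := exists2 e, forall i, M (e i) & x = t0 * \det (famL e).
have [||t OI [_ [e Me ->] npe]] := @ded_scaling _ _ dK _ pp p0 I.
- by move=> _ [e Me ->]; apply: OM.
- by exists (t0 * \det (famL e0)); [exists e0 | rewrite mulf_neq0].
exists e, (t * (t0 * \det (famL e))); split=> //.
- apply: contra_notN npe => /eqP->; rewrite !mulr0.
  by case: pp => [[ip _] _]; apply: (ideal0 ip).
- by apply: OI; exists e.
move=> y My.
exists (fun i => t * (t0 * \det (famL (fun k => if k == i then y else e k)))); split.
  move=> i; apply: OI; eexists; last reflexivity.
  by move=> k /=; case: ifP.
rewrite mulrA -[in LHS]scalerA -cramer_famL scaler_sumr; apply: eq_bigr => i _.
by rewrite scalerA mulrA.
Qed.

(** Near each prime [q] the module spanned by the [y^i b_j] has a basis [e], and [s *: y] acts on it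
    by a matrix over [OK]. Hence [s] times the trace is integral with [s] outside [q], and
    [ded_local_global] concludes. *)
Lemma trLK_integral y : intclos OK y -> OK (trLK y).
Proof.
move=> [p [mp Op py]]; apply: (ded_local_global dK) => q pq q0.
have sO := ded_subring dK.
pose m := (size p).-1.
have ym : y ^+ m = - \sum_(i < m) p`_i *: y ^+ i.
  have sp : size p = m.+1 by rewrite prednK // size_poly_gt0 monic_neq0.
  have lp : p`_m = 1 by rewrite -(monicP mp) lead_coefE.
  apply/eqP; rewrite -addr_eq0 addrC -[in eqbRHS]py horner_coef size_map_poly sp big_ord_recr /=.
  rewrite coef_map lp /= scale1r mul1r; apply/eqP; congr (_ + _).
  by apply: eq_bigr => k _; rewrite coef_map mulr_algl.
have [t [Ot t0] tP] := ded_frac_fin dK (fun x : 'I_m * 'I_d * 'I_d =>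
  rowL (y ^+ x.1.1 * tnth b x.1.2) 0 x.2).
(* One denominator serves all powers of [y], since the monic equation reduces exponents from [m]
   on. *)
have tX i j l : OK (t * rowL (y ^+ i * tnth b j) 0 l).
  elim/ltn_ind: i => i IH.
  have [lt|le] := ltnP i m; first exact: (tP (Ordinal lt, j, l)).
  rewrite -(subnKC le) exprD ym !mulNr !mulr_suml linearN linear_sum mxE summxE.
  rewrite mulrN; apply: (subringN sO); rewrite mulr_sumr; apply: (subring_sum sO) => k _.
  rewrite -!scalerAl -exprD linearZ mxE mulrCA.
  apply: subringM => //; apply: IH.
  by rewrite -[ltnRHS](subnKC le) ltn_add2r.
(* [M] is a set of generators stable under [y]. Each of the [d] rows of a family in [M] is cleared
   by [t], hence [t ^+ d] for the determinant. *)
pose M z := exists i j, z = y ^+ i * tnth b j.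
have [|||e [s [Me de Os qs sP]]] := @local_basis M q (t ^+ d) pq q0.
- by rewrite expf_neq0.
- move=> e Me; rewrite -detZ; apply: (subring_det sO) => i j; rewrite !mxE.
  by have [k [l ->]] := Me i; have := tX k l j; rewrite mxE.
- exists (fun i => tnth b i); last by rewrite famL_vbasis det1 oner_neq0.
  by move=> i; exists 0%N, i; rewrite expr0 mul1r.
have /choice[C CP] : forall i, exists c : 'I_d -> K,
    (forall j, OK (c j)) /\ s *: (y * e i) = \sum_j c j *: e j.
  move=> i; apply: sP; have [k [l ->]] := Me i.
  by exists k.+1, l; rewrite exprS mulrA.
exists s; split=> //.
rewrite -trLKZ (@trLK_frame e _ (\matrix_(i, j) C i j)) //.
  by apply: (subring_sum sO) => i _; rewrite mxE; case: (CP i).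
by move=> i; rewrite -scalerAl; have [_ ->] := CP i; apply: eq_bigr => j _; rewrite mxE.
Qed.
End Frame.
End Coordinates.

(** * Nondegeneracy of the trace of a separable extension *)

Lemma deriv_prod (R : comNzRingType) (I : finType) (F : I -> {poly R}) :
  (\prod_i F i)^`() = \sum_i (F i)^`() * \prod_(k | k != i) F k.
Proof.
elim: (index_enum I) (index_enum_uniq I) => [|x r IH] /=; first by rewrite !big_nil derivC.
case/andP => xr /IH {}IH; rewrite !big_cons eqxx derivM IH mulr_sumr; congr (_ * _ + _).
  rewrite [RHS]big_seq_cond [LHS]big_seq; apply: eq_bigl => k.
  by case: eqVneq => [->|]; rewrite ?(negbTE xr) ?andbT.
rewrite [LHS]big_seq [RHS]big_seq; apply: eq_bigr => i ir.
rewrite big_cons ifT; first by rewrite mulrCA.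
by apply: contraNneq xr => ->.
Qed.

(** Jacobi's formula for [X - A]: differentiating the factor in row [i] leaves only the permutations
    fixing [i], whose sum is the [i]-th diagonal cofactor. *)
Lemma deriv_char_poly (R : comNzRingType) n (A : 'M[R]_n) :
  (char_poly A)^`() = \tr (\adj (char_poly_mx A)).
Proof.
rewrite /char_poly /mxtrace; set M := char_poly_mx A.
under [RHS]eq_bigr do rewrite mxE expand_cofactor.
rewrite raddf_sum /=; under eq_bigr => s _.
  have -> : (-1) ^+ s = ((-1) ^+ s)%:P :> {poly R} by rewrite rmorphXn rmorphN1.
  rewrite mul_polyC derivZ deriv_prod -mul_polyC mulr_sumr; over.
rewrite exchange_big /=; apply: eq_bigr => i _.
rewrite [RHS]big_mkcond /=; apply: eq_bigr => s _.
rewrite !mxE derivB derivC subr0.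
have -> : ('X *+ (i == s i) : {poly R})^`() = (i == s i)%:R.
  by case: eqP; rewrite ?mulr1n ?mulr0n ?derivX ?deriv0.
rewrite eq_sym; case: eqP => _; last by rewrite mul0r mulr0.
rewrite mul1r rmorphXn rmorphN1; congr (_ * _).
by apply: eq_bigl => k; rewrite eq_sym.
Qed.

(** Compare the coefficients of [X^(j+1)]. For [B] the adjugate this gives a descending recursion
    for its coefficients. *)
Lemma coef_char_poly_mx_mul (R : comNzRingType) n (A : 'M[R]_n) (B : 'M[{poly R}]_n) c :
  char_poly_mx A *m B = c%:M -> forall j,
  \matrix_(k, l) (B k l)`_j = A *m (\matrix_(k, l) (B k l)`_j.+1) + (c`_j.+1)%:M.
Proof.
move=> /matrixP E j; apply/matrixP => k l.
have := congr1 (fun q : {poly R} => q`_j.+1) (E k l).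
rewrite mulmxBl mul_scalar_mx !mxE coefB coefXM coef_sum coefMn /= => <-.
rewrite addrC; under eq_bigr do rewrite mxE coefCM.
apply/esym; rewrite addrAC; apply/(canLR (addrK _)); congr (_ + _).
by apply: eq_bigr => i _; rewrite mxE.
Qed.

Section Trace.
Variables (K : fieldType) (L : fieldExtType K).
Local Notation d := (\dim {:L}).
Local Notation b := (vbasis {:L}).

(** The basis itself, as a row over [L], is an eigenvector of the transpose of [mulL y] with
    eigenvalue [y]. *)
Lemma root_char_mulL (y : L) : root (map_poly (in_alg L) (char_poly (mulL y))) y.
Proof.
have -> : map_poly (in_alg L) (char_poly (mulL y)) = char_poly (map_mx (in_alg L) (mulL y)^T).
  rewrite -map_char_poly; congr map_poly; rewrite /char_poly -det_tr; congr (\det _).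
  by apply/matrixP => i j; rewrite !mxE eq_sym.
rewrite -eigenvalue_root_char; apply/eigenvalueP; exists (\row_i tnth b i); last first.
  apply: contraNneq (oner_neq0 L) => /rowP b0; rewrite [1]rowL_sum big1 // => i _.
  by have := b0 i; rewrite !mxE => ->; rewrite scaler0.
apply/rowP => i; rewrite !mxE [y * _](rowL_sum _); apply: eq_bigr => j _.
by rewrite !mxE mulr_algr.
Qed.

(* The coefficients of [adj (X - A)] are polynomials in [A], so their traces are traces of elements;
   if the trace vanished, so would the derivative of the characteristic polynomial of a primitive
   element. *)
Lemma trLK_neq0 : separable 1%VS {:L} -> exists y : L, trLK y != 0.
Proof.
move=> sep; apply: contrapT => H.
have tr0 (y : L) : trLK y = 0 by apply/eqP; apply: contrapT => /negP ny; apply: H; exists y.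
pose th := separable_generator 1%AS {:L}%AS.
have gth : {:L}%VS = <<1; th>>%VS.
  by apply: (@eq_adjoin_separable_generator _ _ {:L}%AS 1%AS) => //; apply: subvf.
have sth : separable_element 1%AS th by apply: separable_generatorP.
pose A := mulL th; pose chi := char_poly A; pose B := \adj (char_poly_mx A).
pose Bc j : 'M[K]_d := \matrix_(k, l) (B k l)`_j.
have BcS j : Bc j = A *m Bc j.+1 + (chi`_j.+1)%:M.
  exact: coef_char_poly_mx_mul (mul_mx_adj _) j.
have [N BN] : exists N, forall j, (N <= j)%N -> Bc j = 0.
  exists (\max_k \max_l size (B k l))%N => j Nj; apply/matrixP => k l; rewrite mxE [RHS]mxE.
  apply: nth_default; apply: leq_trans Nj.
  apply: leq_trans (leq_bigmax (F := fun k => (\max_l size (B k l))%N) k).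
  exact: (leq_bigmax (F := fun l => size (B k l)) l).
(* Descending induction from an index beyond which the coefficients vanish. *)
have BL j : exists y, Bc j = mulL y.
  have [k] : exists k, (N <= j + k)%N by exists N; rewrite leq_addl.
  elim: k j => [|k IH] j Nj.
    by exists 0; rewrite linear0 BN // -[j]addn0.
  have [|y yP] := IH j.+1; first by rewrite addSnnS.
  exists (y * th + chi`_j.+1 *: 1); rewrite BcS yP -mulLM linearD linearZ /=.
  by rewrite mulL1 scalemx1.
have chi0 : chi^`() = 0.
  rewrite deriv_char_poly; apply/polyP => j; rewrite coef0 /mxtrace coef_sum.
  have [y yP] := BL j; transitivity (\tr (Bc j)); last by rewrite yP -trLKE.
  by apply: eq_bigr => i _; rewrite [RHS]mxE.
have root_chi := root_char_mulL th.
have dth : (adjoin_degree 1%AS th) = d.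
  by have := dim_Fadjoin 1%AS th; rewrite -gth dimv1 muln1.
(* Both polynomials are monic of degree [d], so [chi] is the minimal polynomial of [th], whose
   derivative is nonzero by separability. *)
have : minPoly 1%AS th %= map_poly (in_alg L) chi.
  rewrite -dvdp_size_eqp.
    by rewrite size_minPoly size_map_poly size_char_poly dth.
  apply: minPoly_dvdp => //; apply/polyOverP => i; rewrite coef_map; exact: rpredZ (mem1v _).
rewrite eqp_monic ?monic_minPoly ?monic_map ?char_poly_monic // => /eqP E.
by move: sth; rewrite separable_nz_der E deriv_map chi0 rmorph0 eqxx.
Qed.

(** A kernel vector of the Gram matrix is some [y != 0] with trace zero on [y L], and [y L] is all
    of [L]. *)
Lemma disc_vbasis_neq0 : separable 1%VS {:L} -> disc_elt (fun i => tnth b i) != 0.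
Proof.
move=> /trLK_neq0[z]; apply: contraNneq => /eqP/det0P[v v0 /rowP vG].
pose y := \sum_i v 0 i *: tnth b i.
have rv : rowL y = v.
  rewrite linear_sum -[RHS]mulmx1 -famL_vbasis mulmx_sum_row.
  by apply: eq_bigr => i _; rewrite linearZ row_famL.
have y0 : y != 0 by apply: contraNneq v0 => y0; rewrite -rv y0 linear0.
rewrite -[z](mulVKf y0) (rowL_sum (y^-1 * z)) mulr_sumr.
under eq_bigr do rewrite -scalerAr; rewrite trLK_sum big1 // => j _.
have := vG j; rewrite !mxE => E; rewrite [trLK _](_ : _ = 0) ?mulr0 // -[RHS]E mulr_suml.
under eq_bigr do rewrite -scalerAl; rewrite trLK_sum.
by apply: eq_bigr => i _; rewrite !mxE.
Qed.

End Trace.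

(** * Local structure of the integral closure *)

Section Extension.
Variables (K : fieldType) (L : fieldExtType K) (OK : K -> Prop).
Hypothesis dK : dedekind OK.
Local Notation d := (\dim {:L}).
Local Notation b := (vbasis {:L}).
Local Notation OL := (@intclos K L OK).
Let sO := ded_subring dK.
Let sL := @intclos_subring K OK sO L.

(** With [q] the characteristic polynomial of [y] and [a] a common denominator of its coefficients,
    [a^d q(X/a)] is monic, integral and vanishes at [a *: y]. *)
Lemma intclos_frac (y : L) : exists2 a, OK a /\ a != 0 & OL (a *: y).
Proof.
pose q := char_poly (mulL y).
have sq : size q = d.+1 by rewrite size_char_poly.
have [a [Oa a0] aP] := ded_frac_fin dK (fun i : 'I_d => q`_i).
exists a => //; pose r := \poly_(i < d.+1) (q`_i * a ^+ (d - i)).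
have rd : r`_d = 1.
  by rewrite coef_poly ltnSn subnn expr0 mulr1 -(monicP (char_poly_monic (mulL y))) lead_coefE sq.
have sr : size r = d.+1.
  by apply: size_poly_eq; rewrite subnn expr0 mulr1 -[d]/(d.+1.-1) -sq -lead_coefE
    (monicP (char_poly_monic _)) oner_neq0.
exists r; split.
- by rewrite monicE lead_coefE sr rd.
- move=> i; have [lt|le] := ltnP i d; last first.
    have [->|ne] := eqVneq i d; first by rewrite rd; apply: subring1.
    rewrite nth_default; first exact: subring0.
    by rewrite sr ltn_neqAle eq_sym ne.
  rewrite coef_poly ltnS ltnW // -(subnSK lt) exprS mulrA [q`_i * a]mulrC.
  by apply: subringM => //; [apply: (aP (Ordinal lt)) | apply: subringX].
- rewrite horner_coef size_map_poly sr.
  have := root_char_mulL y; rewrite rootE horner_coef size_map_poly -/q sq => /eqP E.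
  transitivity (a ^+ d *: (\sum_(i < d.+1) (map_poly (in_alg L) q)`_i * y ^+ i)).
    rewrite scaler_sumr; apply: eq_bigr => i _; rewrite !coef_map coef_poly ltn_ord /=.
    rewrite !mulr_algl exprZn !scalerA; congr (_ *: _).
    by rewrite -mulrA -exprD subnK 1?mulrC // -ltnS.
  by rewrite E scaler0.
Qed.

Lemma disc_elt_integral (x : 'I_d -> L) : (forall i, OL (x i)) -> OK (disc_elt x).
Proof.
move=> Ox; apply: (subring_det sO) => i j; rewrite mxE; apply: (trLK_integral dK).
by apply: (subringM sL).
Qed.

Lemma disc_ideal_ideal : ideal_of OK (disc_ideal OK OL).
Proof. by apply: gen_ideal_ideal => // _ [x [Ox ->]]; apply: disc_elt_integral. Qed.

Section ExtIdeal.
Variables (n : K -> Prop).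
Hypothesis iN : ideal_of OK n.
Local Notation nL := (ext_ideal OL n).

Lemma ext_ideal_ideal : ideal_of OL nL.
Proof.
apply: gen_ideal_ideal => // _ [a [na ->]]; apply: (intclos_alg sO).
exact: (ideal_sub iN).
Qed.

Lemma ext_idealZ a (y : L) : n a -> OL y -> nL (a *: y).
Proof. by move=> na Oy; rewrite -mulr_algr; apply: gen_idealM => //; exists a. Qed.

Lemma ext_ideal_alg a : n a -> nL a%:A.
Proof. by move=> na; apply: ext_idealZ => //; apply: (subring1 sL). Qed.

Lemma ext_ideal_colon (m : K -> Prop) a (y : L) :
  OK a -> (forall x, n x -> m (a * x)) -> ideal_of OK m -> nL y -> ext_ideal OL m (a *: y).
Proof.
move=> Oa anm im; have iE := ext_ideal_ideal.
have imL : ideal_of OL (ext_ideal OL m).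
  by apply: gen_ideal_ideal => // _ [c [mc ->]]; apply: (intclos_alg sO); apply: (ideal_sub im).
move: y; apply: gen_ideal_ind.
- by rewrite scaler0; apply: (ideal0 imL).
- by move=> x y; rewrite scalerDr; apply: (idealD imL).
- move=> r _ Or [c [nc ->]]; rewrite mulr_algr scalerA -mulr_algr.
  by apply: gen_idealM => //; exists (a * c); split=> //; apply: anm.
Qed.

Lemma ext_ideal_sub (P : L -> Prop) : ideal_of OL P -> (forall a, n a -> P a%:A) ->
  forall y, nL y -> P y.
Proof.
move=> iP nP; apply: gen_ideal_ind; [exact: (ideal0 iP) | exact: (idealD iP) |].
by move=> r _ Or [a [na ->]]; apply: (idealMl iP) => //; apply: nP.
Qed.
End ExtIdeal.

Definition local_frame (p : K -> Prop) (e : 'I_d -> L) s :=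
  [/\ forall i, OL (e i), \det (famL e) != 0, OK s, ~ p s &
    forall y, OL y -> exists c : 'I_d -> K, (forall i, OK (c i)) /\ s *: y = \sum_i c i *: e i].

(* [disc(b)] is a common denominator for the determinants of integral families, because
   [(disc(b) det(e))^2 = disc(b) disc(e)]. *)
Lemma exists_local_frame p : separable 1%VS {:L} -> prime_ideal OK p -> nonzero_ideal p ->
  exists e s, local_frame p e s.
Proof.
move=> sep pp p0; pose D : K := disc_elt (fun i => tnth b i).
have D0 : D != 0 by apply: disc_vbasis_neq0.
have [t [Ot t0] OtD] := ded_frac dK D.
apply: (@local_basis K L OK dK OL p (t * D)) => //; first by rewrite mulf_neq0.
  move=> e Oe; apply: (ded_sqrt dK).
  have -> : (t * D * \det (famL e)) ^+ 2 = t * (t * D) * disc_elt e.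
    by rewrite disc_famL -/D; ring.
  by do 2?apply: subringM => //; apply: disc_elt_integral.
have /choice[a aP] : forall i : 'I_d, exists a, [/\ OK a, a != 0 & OL (a *: tnth b i)].
  by move=> i; have [a [? ?] ?] := intclos_frac (tnth b i); exists a.
exists (fun i => a i *: tnth b i); first by move=> i; case: (aP i).
have -> : famL (fun i => a i *: tnth b i) = diag_mx (\row_i a i).
  rewrite -[RHS]mulmx1 -famL_vbasis; apply/famL_mul => i.
  rewrite (bigD1 i) //= big1 ?addr0; first by rewrite !mxE eqxx.
  by move=> j ji; rewrite !mxE eq_sym (negbTE ji) scale0r.
rewrite det_diag; apply/prodf_neq0 => i _; rewrite mxE; by case: (aP i).
Qed.

Section Frame.
Variables (p : K -> Prop) (e : 'I_d -> L) (s : K).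
Hypotheses (pp : prime_ideal OK p) (p0 : nonzero_ideal p) (fr : local_frame p e s).
Let mp : maximal_ideal OK p := ded_maximal dK pp p0.
Let ip : ideal_of OK p. Proof. by case: pp => [[]]. Qed.
Local Notation pL := (ext_ideal OL p).
Let ipL : ideal_of OL pL := ext_ideal_ideal ip.
Let Oe i : OL (e i). Proof. by case: fr. Qed.
Let Os : OK s. Proof. by case: fr. Qed.
Let nps : ~ p s. Proof. by case: fr. Qed.

Lemma frame_cancel a : OK a -> p (s * a) -> p a.
Proof. by move=> Oa; case: pp => _ /(_ _ _ Os Oa) H /H[]. Qed.

Lemma frame_ext y : pL y -> exists c : 'I_d -> K, (forall i, p (c i)) /\
  s *: y = \sum_i c i *: e i.
Proof.
move: y; apply: gen_ideal_ind.
- exists (fun=> 0); split=> [_|]; first exact: (ideal0 ip).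
  by rewrite scaler0 big1 // => i _; rewrite scale0r.
- move=> x y [c [pc E]] [c' [pc' E']]; exists (fun i => c i + c' i).
  split=> [i|]; first exact: (idealD ip).
  by rewrite scalerDr E E' -big_split; apply: eq_bigr => i _; rewrite scalerDl.
- move=> r _ Or [a [pa ->]]; case: fr => _ _ _ _ /(_ r Or)[c [Oc E]].
  exists (fun i => a * c i); split=> [i /=|]; first by apply: (ideal_mulr ip).
  rewrite mulr_algr scalerA mulrC -scalerA E scaler_sumr.
  by apply: eq_bigr => i _; rewrite scalerA.
Qed.

Lemma frame_free (c c' : 'I_d -> K) : \sum_i c i *: e i = \sum_i c' i *: e i -> c =1 c'.
Proof.
move=> E; have uE : famL e \in unitmx by rewrite unitmxE unitfE; case: fr.
have H (f : 'I_d -> K) : rowL (\sum_i f i *: e i) = (\row_i f i) *m famL e.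
  rewrite linear_sum mulmx_sum_row; apply: eq_bigr => i _.
  by rewrite linearZ row_famL mxE.
move=> i; have := congr1 (fun y => rowL y *m invmx (famL e)) E.
by rewrite /= !H !mulmxK // => /rowP/(_ i); rewrite !mxE.
Qed.

Lemma frame_unit y : OL y -> pL (s *: y) -> pL y.
Proof.
move=> Oy psy; have [t Ot pt] := maximal_inv sO mp Os nps.
have -> : y = t *: (s *: y) - (s * t - 1) *: y.
  by rewrite scalerBl scale1r scalerA mulrC opprB addrC subrK.
apply: (idealB sL ipL); last exact: ext_idealZ.
by rewrite -mulr_algl; apply: (idealMl ipL) => //; apply: (intclos_alg sO).
Qed.

Lemma frame_indep (c : 'I_d -> K) : (forall i, OK (c i)) -> pL (\sum_i c i *: e i) ->
  forall i, p (c i).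
Proof.
move=> Oc /frame_ext[c' [pc']]; rewrite scaler_sumr => E i.
apply: frame_cancel => //; rewrite -[s * _](_ : c' i = _) //.
apply: (@frame_free c' (fun i => s * c i)).
by rewrite -E; apply: eq_bigr => j _; rewrite scalerA.
Qed.

Lemma frame_gen y : OL y -> exists c : 'I_d -> K, (forall i, OK (c i)) /\
  pL (y - \sum_i c i *: e i).
Proof.
move=> Oy; have [t Ot pt] := maximal_inv sO mp Os nps.
case: fr => _ _ _ _ /(_ y Oy)[c [Oc E]].
exists (fun i => t * c i); split=> [i|]; first exact: subringM.
have -> : \sum_i (t * c i) *: e i = t *: (s *: y).
  by rewrite E scaler_sumr; apply: eq_bigr => i _; rewrite scalerA.
rewrite scalerA -[X in X - _]scale1r -scalerBl; apply: ext_idealZ => //.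
by rewrite mulrC; apply: (ideal_subC sO ip).
Qed.

Lemma frame_residue : residue_degree OK OL p pL d.
Proof. by exists e; split=> //; [apply: frame_gen | apply: frame_indep]. Qed.

(** Multiplication by [s] turns the congruences into equations: [s *: y] acts on [e] exactly by
    [s *: T + R], where [R] has entries in [p]. *)
Lemma frame_trace y (T : 'M[K]_d) : OL y -> (forall i j, OK (T i j)) ->
  (forall i, pL (y * e i - \sum_j T i j *: e j)) -> p (trLK y - \tr T).
Proof.
move=> Oy OT yT.
have /choice[R RP] : forall i, exists c : 'I_d -> K, (forall j, p (c j)) /\
    s *: (y * e i - \sum_j T i j *: e j) = \sum_j c j *: e j.
  by move=> i; apply: frame_ext.
have Otr : OK (\tr T) by apply: (subring_sum sO).
apply: frame_cancel; first by apply: subringB => //; apply: trLK_integral.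
have de : \det (famL e) != 0 by case: fr.
have -> : s * (trLK y - \tr T) = \tr (\matrix_(i, j) R i j).
  rewrite mulrBr -trLKZ (@trLK_frame _ _ e _ (s *: T + \matrix_(i, j) R i j)) //.
    by rewrite mxtraceD mxtraceZ addrC addKr.
  move=> i; rewrite -scalerAl; apply/eqP; rewrite -subr_eq0; apply/eqP.
  have [_ E] := RP i; move/eqP: E; rewrite scalerBr subr_eq => /eqP->.
  rewrite scaler_sumr -big_split -sumrB big1 // => j _.
  by rewrite !mxE scalerDl scalerA [X in X - _]addrC subrr.
by apply: (ideal_sum ip) => i _; rewrite mxE; case: (RP i).
Qed.

(** [s x = C e] gives [s^(2d) disc(x) = det(C)^2 disc(e)], and [s] is outside [p]. So [disc_elt e]
    alone decides whether [p] contains the discriminant ideal. *)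
Lemma frame_disc (x : 'I_d -> L) : (forall i, OL (x i)) -> p (disc_elt e) -> p (disc_elt x).
Proof.
move=> Ox pe.
have /choice[C CP] : forall i, exists c : 'I_d -> K, (forall j, OK (c j)) /\
    s *: x i = \sum_j c j *: e j.
  by move=> i; case: fr => _ _ _ _; apply.
have E : s ^+ d * \det (famL x) = \det (\matrix_(i, j) C i j) * \det (famL e).
  rewrite -detZ -det_mulmx; congr (\det _).
  transitivity (famL (fun i => s *: x i)); first by apply/matrixP => i j; rewrite !mxE linearZ.
  apply/famL_mul => i; have [_ ->] := CP i.
  by apply: eq_bigr => j _; rewrite mxE.
have H : p ((s ^+ d) ^+ 2 * disc_elt x).
  rewrite disc_famL mulrA -exprMn E exprMn -mulrA -disc_famL.
  apply: (idealMl ip) => //; apply: subringX => //; apply: subring_det => // i j.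
  by rewrite mxE; case: (CP i).
have Od := disc_elt_integral Ox.
have [H1|//] := (proj2 pp) _ _ (subringX sO 2 (subringX sO d Os)) Od H.
case: nps; apply: (prime_nX sO pp Os (m := d)).
by apply: (prime_nX sO pp _ H1); apply: subringX.
Qed.
End Frame.
End Extension.

(** * Finite quotient rings *)

(** Packs all the data on which the ring structure of the quotient depends. The quotient is carried
    by the indices of the representatives. *)
Record quot_data (R : comNzRingType) (S I : R -> Prop) := QuotData {
  qd_card : nat;
  qd_rep : 'I_qd_card -> R;
  qd_subring : subring S;
  qd_ideal : ideal_of S I;
  qd_proper : ~ I 1;
  qd_repS : forall i, S (qd_rep i);
  qd_repI : forall i j, I (qd_rep i - qd_rep j) -> i = j;
  qd_repP : forall x, S x -> exists i, I (x - qd_rep i) }.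

Section QuotientRing.
Variables (R : comNzRingType) (S I : R -> Prop) (Q : quot_data S I).
Let sS := qd_subring Q.
Let iI := qd_ideal Q.

Definition quot_ring := 'I_(qd_card Q).
Local Notation rep := (@qd_rep _ _ _ Q).

(** The premise [S x] stands inside the existential so that choice yields a class function on all of
    [R], with arbitrary values outside [S]. *)
Lemma quot_class_ex x : exists i, S x -> I (x - rep i).
Proof.
have [Sx|nSx] := pselect (S x); first by have [i] := qd_repP Q Sx; exists i.
by have [i _] := qd_repP Q (subring0 sS); exists i.
Qed.

Definition quot_class x : quot_ring := sval (cid (quot_class_ex x)).

Lemma quot_classP x : S x -> I (x - rep (quot_class x)).
Proof. by rewrite /quot_class; case: cid. Qed.

Lemma quot_class_eq x y : S x -> S y -> quot_class x = quot_class y <-> I (x - y).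
Proof.
move=> Sx Sy; have Ix := quot_classP Sx; have Iy := quot_classP Sy.
split=> [e|Ixy].
  by rewrite e in Ix; apply: (ideal_trans iI Ix); apply: (ideal_subC sS iI).
apply: (qd_repI (q := Q)); apply: (ideal_trans iI) Iy.
by apply: (ideal_trans iI) Ixy; apply: (ideal_subC sS iI).
Qed.

Lemma quot_class_rep i : quot_class (rep i) = i.
Proof.
by apply: (qd_repI (q := Q)); apply: (ideal_subC sS iI); apply: quot_classP; apply: qd_repS.
Qed.

Let Srep i : S (rep i). Proof. exact: qd_repS. Qed.

Definition quot_add (a b : quot_ring) := quot_class (rep a + rep b).
Definition quot_opp (a : quot_ring) := quot_class (- rep a).
Definition quot_mul (a b : quot_ring) := quot_class (rep a * rep b).

Lemma quot_addE x y : S x -> S y -> quot_add (quot_class x) (quot_class y) = quot_class (x + y).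
Proof.
move=> Sx Sy; apply/quot_class_eq; try exact: (subringD sS).
have -> : rep (quot_class x) + rep (quot_class y) - (x + y)
   = - ((x - rep (quot_class x)) + (y - rep (quot_class y))) by ring.
by apply: (idealN sS iI); apply: (idealD iI); apply: quot_classP.
Qed.

Lemma quot_mulE x y : S x -> S y -> quot_mul (quot_class x) (quot_class y) = quot_class (x * y).
Proof.
move=> Sx Sy; apply/quot_class_eq; try exact: (subringM sS).
apply: (ideal_subM iI) => //; apply: (ideal_subC sS iI); exact: quot_classP.
Qed.

Lemma quot_oppE x : S x -> quot_opp (quot_class x) = quot_class (- x).
Proof.
move=> Sx; apply/quot_class_eq; try exact: (subringN sS).
by rewrite opprK addrC; apply: quot_classP.
Qed.

Lemma quot_class_surj (a : quot_ring) : exists2 x, S x & a = quot_class x.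
Proof. by exists (rep a) => //; rewrite quot_class_rep. Qed.

Lemma quot_addA : associative quot_add.
Proof.
move=> a b c; have [x Sx ->] := quot_class_surj a; have [y Sy ->] := quot_class_surj b.
have [z Sz ->] := quot_class_surj c.
by rewrite !quot_addE ?addrA //; apply: subringD.
Qed.
Lemma quot_addC : commutative quot_add.
Proof. by move=> a b; rewrite /quot_add addrC. Qed.
Lemma quot_add0 : left_id (quot_class 0) quot_add.
Proof.
move=> a; have [x Sx ->] := quot_class_surj a.
by rewrite quot_addE ?add0r //; apply: subring0.
Qed.
Lemma quot_addN : left_inverse (quot_class 0) quot_opp quot_add.
Proof.
move=> a; have [x Sx ->] := quot_class_surj a.
by rewrite quot_oppE // quot_addE ?addNr //; apply: subringN.
Qed.
Lemma quot_mulA : associative quot_mul.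
Proof.
move=> a b c; have [x Sx ->] := quot_class_surj a; have [y Sy ->] := quot_class_surj b.
have [z Sz ->] := quot_class_surj c.
by rewrite !quot_mulE ?mulrA //; apply: subringM.
Qed.
Lemma quot_mulC : commutative quot_mul.
Proof. by move=> a b; rewrite /quot_mul mulrC. Qed.
Lemma quot_mul1 : left_id (quot_class 1) quot_mul.
Proof.
move=> a; have [x Sx ->] := quot_class_surj a.
by rewrite quot_mulE ?mul1r //; apply: subring1.
Qed.
Lemma quot_mulD : left_distributive quot_mul quot_add.
Proof.
move=> a b c; have [x Sx ->] := quot_class_surj a; have [y Sy ->] := quot_class_surj b.
have [z Sz ->] := quot_class_surj c.
have Sxz := subringM sS Sx Sz; have Syz := subringM sS Sy Sz.
by rewrite (quot_addE Sx Sy) !quot_mulE ?quot_addE ?mulrDl //; apply: subringD.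
Qed.
Lemma quot_1neq0 : quot_class 1 != quot_class 0.
Proof.
apply/eqP => /quot_class_eq; rewrite subr0.
by move=> /(_ (subring1 sS) (subring0 sS)); apply: qd_proper Q.
Qed.

HB.instance Definition _ := Finite.on quot_ring.
HB.instance Definition _ :=
  GRing.isZmodule.Build quot_ring quot_addA quot_addC quot_add0 quot_addN.
HB.instance Definition _ := GRing.Zmodule_isComNzRing.Build quot_ring
  quot_mulA quot_mulC quot_mul1 quot_mulD quot_1neq0.
End QuotientRing.

(** The interface through which quotients are used: [phi] is defined on [R] but is a homomorphism
    only on [S], where its kernel is [I]. *)
Record quot_morph (R : comNzRingType) (S I : R -> Prop) (B : comNzRingType) (phi : R -> B) :=
  QuotMorph {
    qm1 : phi 1 = 1;
    qmD : forall x y, S x -> S y -> phi (x + y) = phi x + phi y;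
    qmM : forall x y, S x -> S y -> phi (x * y) = phi x * phi y;
    qm_eq0 : forall x, S x -> phi x = 0 <-> I x;
    qm_surj : forall a, exists2 x, S x & phi x = a }.

Section QuotMorphTheory.
Variables (R : comNzRingType) (S I : R -> Prop) (B : comNzRingType) (phi : R -> B).
Hypotheses (sS : subring S) (Q : quot_morph S I phi).

Lemma qm0 : phi 0 = 0.
Proof.
apply: (addrI (phi 0)); have S0 := subring0 sS.
by rewrite -(qmD Q) // !addr0.
Qed.

Lemma qmB x y : S x -> S y -> phi (x - y) = phi x - phi y.
Proof.
move=> Sx Sy; apply: (addIr (phi y)).
by rewrite -(qmD Q) ?subrK //; apply: subringB.
Qed.

Lemma qm_eq x y : S x -> S y -> phi x = phi y <-> I (x - y).
Proof.
move=> Sx Sy; rewrite -(qm_eq0 Q) ?qmB //; last exact: subringB.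
by split=> [->|/eqP]; [rewrite subrr | rewrite subr_eq0 => /eqP].
Qed.

Lemma qmX x m : S x -> phi (x ^+ m) = phi x ^+ m.
Proof.
move=> Sx; elim: m => [|m IH]; first by rewrite !expr0 (qm1 Q).
by rewrite !exprS (qmM Q) ?IH //; apply: subringX.
Qed.

Lemma qm_sum (J : Type) (r : seq J) (P : pred J) (F : J -> R) :
  (forall i, P i -> S (F i)) -> phi (\sum_(i <- r | P i) F i) = \sum_(i <- r | P i) phi (F i).
Proof.
move=> SF; suff [] : S (\sum_(i <- r | P i) F i) /\
  phi (\sum_(i <- r | P i) F i) = \sum_(i <- r | P i) phi (F i) by [].
apply: (big_ind2 (fun x y => S x /\ phi x = y)) => [|x a y b [Sx <-] [Sy <-]|i Pi].
- by split; [apply: subring0 | apply: qm0].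
- by split; [apply: subringD | apply: (qmD Q)].
- by split=> //; apply: SF.
Qed.

Lemma qm_prod (J : Type) (r : seq J) (P : pred J) (F : J -> R) :
  (forall i, P i -> S (F i)) -> phi (\prod_(i <- r | P i) F i) = \prod_(i <- r | P i) phi (F i).
Proof.
move=> SF; suff [] : S (\prod_(i <- r | P i) F i) /\
  phi (\prod_(i <- r | P i) F i) = \prod_(i <- r | P i) phi (F i) by [].
apply: (big_ind2 (fun x y => S x /\ phi x = y)) => [|x a y b [Sx <-] [Sy <-]|i Pi].
- by split; [apply: subring1 | apply: (qm1 Q)].
- by split; [apply: subringM | apply: (qmM Q)].
- by split=> //; apply: SF.
Qed.

Lemma qm_det m (A : 'M[R]_m) : (forall i j, S (A i j)) -> phi (\det A) = \det (map_mx phi A).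
Proof.
move=> SA; have SN1 : S (- 1) by apply: subringN => //; apply: subring1.
have Sprod (t : 'S_m) : S (\prod_i A i (t i)) by apply: subring_prod.
rewrite qm_sum => [|t _]; last by apply: subringM => //; apply: subringX.
apply: eq_bigr => t _; rewrite (qmM Q) //; last exact: subringX.
rewrite qmX // qm_prod //; congr (_ ^+ _ * _).
  by rewrite -sub0r qmB ?qm0 ?(qm1 Q) ?sub0r //; [apply: subring0 | apply: subring1].
by apply: eq_bigr => i _; rewrite mxE.
Qed.
End QuotMorphTheory.

Lemma quot_ring_exists (R : comNzRingType) (S I : R -> Prop) N :
  subring S -> ideal_of S I -> ~ I 1 -> quot_card S I N ->
  exists (B : finComNzRingType) (phi : R -> B), quot_morph S I phi /\ #|B| = N.
Proof.
move=> sS iI I1 [f [Sf finj fsurj]].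
pose Q := QuotData sS iI I1 Sf finj fsurj.
exists (quot_ring Q), (@quot_class _ _ _ Q); split; last exact: card_ord.
split=> [//|x y Sx Sy|x y Sx Sy|x Sx|a].
- by rewrite [RHS]quot_addE.
- by rewrite [RHS]quot_mulE.
- by rewrite [0]/(quot_class Q 0) quot_class_eq ?subr0 //; apply: subring0.
- by have [x Sx ->] := quot_class_surj a; exists x.
Qed.

Section FiniteDomain.
Variable B : finComNzRingType.
Hypothesis domB : forall x y : B, x * y = 0 -> x = 0 \/ y = 0.

(** A copy of [B] indexed by the proof [domB], so that a field structure can be attached to it. *)
Definition fin_domain of (forall x y : B, x * y = 0 -> x = 0 \/ y = 0) := (B : Type).
Local Notation F := (fin_domain domB).
HB.instance Definition _ := Finite.on F.
HB.instance Definition _ := GRing.ComNzRing.on F.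

Definition fin_inv (x : F) : F := odflt 0 [pick y | x * y == 1].

Lemma fin_mulV (x : F) : x != 0 -> fin_inv x * x = 1.
Proof.
move=> x0; rewrite /fin_inv; case: pickP => [y /eqP|H] /=; first by rewrite mulrC.
have inj : injective (fun y : F => x * y).
  move=> y z e; apply/eqP; rewrite -subr_eq0; apply/eqP.
  by have [|/eqP|//] := domB (x := x) (y := y - z); [rewrite mulrBr e subrr | rewrite (negbTE x0)].
have := injF_onto inj 1 => /codomP[y e].
by have := H y; rewrite -e eqxx.
Qed.

Lemma fin_inv0 : fin_inv 0 = 0.
Proof.
rewrite /fin_inv; case: pickP => [y|//] /=.
by rewrite mul0r eq_sym oner_eq0.
Qed.

HB.instance Definition _ := GRing.ComNzRing_isField.Build F fin_mulV fin_inv0.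
End FiniteDomain.

Lemma quot_field_exists (R : comNzRingType) (S I : R -> Prop) N :
  subring S -> prime_ideal S I -> quot_card S I N ->
  exists (F : finFieldType) (phi : R -> F), quot_morph S I phi /\ #|F| = N.
Proof.
move=> sS [[iI I1] pI] qI; have [B [phi [Q cB]]] := quot_ring_exists sS iI I1 qI.
have domB (x y : B) : x * y = 0 -> x = 0 \/ y = 0.
  have [u Su <-] := qm_surj Q x; have [v Sv <-] := qm_surj Q y.
  have Suv := subringM sS Su Sv.
  rewrite -(qmM Q) // (qm_eq0 Q) // (qm_eq0 Q) // (qm_eq0 Q) //; exact: pI.
by exists (fin_domain domB), phi; split=> //; case: Q.
Qed.

Section QuotCard.
Variables (R : comNzRingType) (S I : R -> Prop).
Hypotheses (sS : subring S) (iI : ideal_of S I).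

Lemma quot_cardT (T : finType) (g : T -> R) : (forall i, S (g i)) ->
  (forall i j, I (g i - g j) -> i = j) -> (forall x, S x -> exists i, I (x - g i)) ->
  quot_card S I #|T|.
Proof.
move=> Sg gI gS; exists (fun i => g (enum_val i)); split=> [i|i j|x Sx] //.
  by move/gI/enum_val_inj.
by have [i Ii] := gS x Sx; exists (enum_rank i); rewrite enum_rankK.
Qed.

Lemma quot_card_le N N' : quot_card S I N -> quot_card S I N' -> (N <= N')%N.
Proof.
move=> [f [Sf fI fS]] [g [Sg gI gS]].
have /choice[h hP] : forall i, exists j, I (f i - g j) by move=> i; apply: gS.
rewrite -[N]card_ord -[N']card_ord; apply: (@leq_card _ _ h) => i j e; apply: fI.
apply: (ideal_trans iI (hP i)); rewrite e; exact: (ideal_subC sS iI).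
Qed.

Lemma quot_card_uniq N N' : quot_card S I N -> quot_card S I N' -> N = N'.
Proof. by move=> q q'; apply/eqP; rewrite eqn_leq !quot_card_le. Qed.

End QuotCard.

Lemma quot_card_sup (R : comNzRingType) (S I J : R -> Prop) N : subring S -> ideal_of S J ->
  (forall x, I x -> J x) -> quot_card S I N -> exists N', quot_card S J N'.
Proof.
move=> sS iJ IJ [f [Sf fI fS]].
(* Representatives modulo [J]: the least index in each class. *)
pose A := [pred i : 'I_N | [forall j : 'I_N, (j < i)%N ==> ~~ `[< J (f i - f j) >]]].
exists #|{: {i | i \in A}}|; apply: (quot_cardT (g := fun i : {i | i \in A} => f (val i))).
- by move=> i; apply: Sf.
- move=> [i Ai] [j Aj] /= Jij; apply: val_inj => /=.
  case: (ltngtP i j) => [lt|lt|/val_inj //].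
    move/forallP: Aj => /(_ i); rewrite lt /= => /negP[]; apply/asboolP.
    exact: (ideal_subC sS iJ).
  by move/forallP: Ai => /(_ j); rewrite lt /= => /negP[]; apply/asboolP.
- move=> x Sx; have [i0 Ii0] := fS x Sx.
  have Pi0 : `[< J (x - f i0) >] by apply/asboolP; apply: IJ.
  case: (@arg_minnP _ i0 (fun i => `[< J (x - f i) >]) (fun i => val i) Pi0) => i /asboolP Ji min.
  suff Ai : i \in A by exists (exist _ i Ai).
  apply/forallP => j; apply/implyP => lt; apply/negP => /asboolP Jij.
  have := min j; rewrite leqNgt lt => H; suff: false by [].
  by apply: H; apply/asboolP; apply: (ideal_trans iJ Ji Jij).
Qed.

(** * Residue degrees *)

Section Residue.
Variables (K : fieldType) (L : fieldExtType K) (OK : K -> Prop).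
Hypothesis dK : dedekind OK.
Local Notation d := (\dim {:L}).
Local Notation OL := (@intclos K L OK).
Let sO := ded_subring dK.
Let sL := @intclos_subring K OK sO L.

Section Over.
Variables (p : K -> Prop) (P : L -> Prop).
Hypotheses (ip : ideal_of OK p) (iP : ideal_of OL P).
Hypothesis (pP : forall a, p a -> P a%:A).

Let PZ a y : p a -> OL y -> P (a *: y).
Proof. by move=> pa Oy; rewrite -mulr_algl; apply: (ideal_mulr iP) => //; apply: pP. Qed.
Let ZP a y : OK a -> P y -> P (a *: y).
Proof. by move=> pa Oy; rewrite -mulr_algl; apply: (idealMl iP) => //; apply: (intclos_alg sO). Qed.

(** Representatives are the combinations of the basis with coefficients among those of [OK/p]. It
    serves for a prime [P] over [p] and also for [nL] over [n], with [f = d]. *)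
Lemma quot_card_residue f N : residue_degree OK OL p P f -> quot_card OK p N ->
  quot_card OL P (N ^ f)%N.
Proof.
move=> [e [Oe gen ind]] [r [Or rI rS]].
pose g (h : {ffun 'I_f -> 'I_N}) : L := \sum_i r (h i) *: e i.
have -> : (N ^ f)%N = #|{: {ffun 'I_f -> 'I_N}}| by rewrite card_ffun !card_ord.
apply: (quot_cardT (g := g)).
- by move=> h; apply: (subring_sum sL) => i _; apply: (intclosZ sO).
- move=> h h' H; apply/ffunP => i; apply: rI; move: i; apply: ind.
    by move=> i; apply: subringB.
  by move: H; rewrite /g -sumrB; congr P; apply: eq_bigr => i _; rewrite scalerBl.
- move=> y /gen[c [Oc yc]].
  have /choice[h hP] : forall i, exists j, p (c i - r j) by move=> i; apply: rS.
  exists [ffun i => h i]; apply: (ideal_trans iP yc).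
  rewrite /g -sumrB; apply: (ideal_sum iP) => i _; rewrite ffunE -scalerBl.
  exact: PZ.
Qed.

(** A generating family of minimal length is independent: a relation with a coefficient outside [p]
    would allow one member to be eliminated. *)
Lemma residue_degree_exists m (e0 : 'I_m -> L) : maximal_ideal OK p ->
  (forall i, OL (e0 i)) ->
  (forall y, OL y -> exists c : 'I_m -> K, (forall i, OK (c i)) /\ P (y - \sum_i c i *: e0 i)) ->
  exists f, residue_degree OK OL p P f.
Proof.
move=> mp Oe0 gen0.
pose sp m := `[< exists e : 'I_m -> L, (forall i, OL (e i)) /\
  forall y, OL y -> exists c : 'I_m -> K, (forall i, OK (c i)) /\ P (y - \sum_i c i *: e i) >].
have spm : sp m by apply/asboolP; exists e0.
have {m e0 Oe0 gen0 spm} [f /asboolP[e [Oe gen]] min] := ex_minnP (ex_intro sp m spm).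
exists f, e; split=> //; case: f e Oe gen min => [|f] e Oe gen min c Oc Pc j; first by case: j.
apply: contrapT => npc.
suff /min : sp f by rewrite ltnn.
have [t Ot pt] := maximal_inv sO mp (Oc j) npc.
apply/asboolP; exists (fun k => e (lift j k)); split=> [k|y Oy]; first exact: Oe.
have [a [Oa ya]] := gen y Oy.
(* Substitutes [e j = - t sum_k c_k e_k] modulo [P], with [t] inverse to [c j] modulo [p]. *)
exists (fun k => a (lift j k) - t * a j * c (lift j k)); split.
  by move=> k; apply: subringB => //; do !apply: subringM => //.
have -> : y - \sum_k (a (lift j k) - t * a j * c (lift j k)) *: e (lift j k)
  = (y - \sum_i a i *: e i) + ((t * a j) *: \sum_i c i *: e i - (a j * (c j * t - 1)) *: e j).
  rewrite !(bigD1_ord j) //=.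
  under eq_bigr do rewrite scalerBl -scalerA.
  rewrite sumrB -scaler_sumr scalerDr scalerA.
  set X := \sum_(i < f) a _ *: _; set Y := _ *: \sum_(i < f) _.
  have -> : t * a j * c j = a j * (c j * t) by ring.
  rewrite mulrBr mulr1 scalerBl; set U := (a j * _) *: e j; set V := a j *: e j.
  by rewrite !opprB !opprD; ring.
apply: (idealD iP) => //; apply: (idealB sL iP); first by apply: ZP => //; apply: subringM.
by apply: PZ => //; apply: (idealMl ip).
Qed.
End Over.

(** The colon [(n : p)] is not contained in [p]. This form of square-freeness passes from [n] to
    [(n : p)] and holds vacuously for the unit ideal, where the induction below ends. *)
Definition locally_coprime_colon (n : K -> Prop) := forall p, prime_ideal OK p ->
  (forall x, n x -> p x) -> exists u, [/\ OK u, ~ p u & forall x, p x -> n (u * x)].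

(** The [a] with [a y] in [nL] form an ideal containing [n]. Inside a maximal [M] it could not be:
    [y] is in [ML], so the [u] outside [M] with [u M] in [n] belongs to it. *)
Lemma ext_ideal_local n (y : L) : ideal_of OK n -> locally_coprime_colon n -> OL y ->
  (forall p, prime_ideal OK p -> (forall x, n x -> p x) -> ext_ideal OL p y) -> ext_ideal OL n y.
Proof.
move=> iN cN Oy loc; have iNL := ext_ideal_ideal L dK iN.
pose J a := OK a /\ ext_ideal OL n (a *: y).
have iJ : ideal_of OK J.
  split.
  - by move=> a [].
  - by split; [apply: subring0 | rewrite scale0r; apply: (ideal0 iNL)].
  - by move=> a c [Oa Ja] [Oc Jc]; split;
      [apply: subringD | rewrite scalerDl; apply: (idealD iNL)].
  - move=> r a Or [Oa Ja]; split; first exact: subringM.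
    rewrite -scalerA -mulr_algl; apply: (idealMl iNL) => //; exact: (intclos_alg sO).
have [[_]|nJ1] := pselect (J 1); first by rewrite scale1r.
have [M mM JM] := exists_maximal sO (ded_noetherian dK) iJ nJ1.
have pM := maximal_prime sO mM; have [iM _] := proj1 pM.
have nM x : n x -> M x.
  by move=> nx; apply: JM; split; [apply: (ideal_sub iN) | apply: ext_idealZ].
have [u [Ou nMu un]] := cN M pM nM.
case: nMu; apply: JM; split=> //.
exact: (ext_ideal_colon dK iM Ou un iN (loc M pM nM)).
Qed.

Lemma ext_ideal_mono (m n : K -> Prop) : (forall x, m x -> n x) ->
  forall y, ext_ideal OL m y -> ext_ideal OL n y.
Proof.
move=> mn y [s [sP ->]]; exists s; split=> // q /sP[Oq [a [ma ->]]]; split=> //.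
by exists a; split=> //; apply: mn.
Qed.

Hypothesis sep : separable 1%VS {:L}.

(** Noetherian induction with the Chinese remainder theorem: for a prime [p] above [n] and
    [m = (n : p)], [m] is strictly larger than [n], comaximal with [p], and [m p] lies in [n]. *)
Lemma ext_ideal_residue n : ideal_of OK n -> nonzero_ideal n -> locally_coprime_colon n ->
  residue_degree OK OL n (ext_ideal OL n) d.
Proof.
move=> iN; move: n iN; apply: (noetherian_ind sO (ded_noetherian dK)) => n iN IH n0 cN.
have iNL := ext_ideal_ideal L dK iN.
have [n1|nn1] := pselect (n 1).
  have nall a : OK a -> n a by apply: (ideal1 iN).
  (* Modulo the unit ideal any family of length [d] is a basis. *)
  exists (fun=> 0); split=> [i|y Oy|c Oc _ i]; [exact: (subring0 sL) | | exact: nall].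
  exists (fun=> 0); split=> [i|]; first exact: subring0.
  rewrite big1 ?subr0 => [|i _]; last by rewrite scale0r.
  by rewrite -[y]scale1r; apply: ext_idealZ.
have [p mp np] := exists_maximal sO (ded_noetherian dK) iN nn1.
have pp := maximal_prime sO mp; have [ip _] := proj1 pp.
have p0 : nonzero_ideal p by have [x [nx x0]] := n0; exists x; split=> //; apply: np.
have [u [Ou npu un]] := cN p pp np.
pose m a := OK a /\ forall q, p q -> n (a * q).
have im : ideal_of OK m by apply: ideal_colon.
have nm x : n x -> m x.
  move=> nx; split=> [|q pq]; first exact: (ideal_sub iN).
  by apply: (ideal_mulr iN) => //; apply: (ideal_sub ip).
have [|||e' [Oe' gen' ind']] := IH m im nm.
- by exists u; [split | move=> /np].
- by have [x [nx x0]] := n0; exists x; split=> //; apply: nm.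
- move=> q pq mq; have [|v [Ov nqv vn]] := cN q pq; first by move=> x /nm /mq.
  by exists v; split=> // x /vn /nm.
have [e2 [s fr]] := exists_local_frame dK sep pp p0.
have [e'' [Oe'' gen'' ind'']] := frame_residue dK pp p0 fr.
have iML := ext_ideal_ideal L dK im; have iPL := ext_ideal_ideal L dK ip.
have [a [b [ma pb ab]]] : exists a b, [/\ m a, p b & a + b = 1].
  by apply: (maximal_coprime sO mp im); exists u.
have Oa := ideal_sub im ma; have Ob := ideal_sub ip pb.
have mn x y : m x -> p y -> n (x * y) by move=> [_ H] /H.
have aP y : ext_ideal OL p y -> ext_ideal OL n (a *: y).
  by apply: (ext_ideal_colon dK ip Oa _ iN) => x px; apply: mn.
have bM y : ext_ideal OL m y -> ext_ideal OL n (b *: y).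
  by apply: (ext_ideal_colon dK im Ob _ iN) => x mx; rewrite mulrC; apply: mn.
(* Since [a + b = 1], the glued family is [e'] modulo [m] and [e''] modulo [p]; the coefficients
   chosen below are glued in the same way. *)
pose e i := b *: e' i + a *: e'' i.
have Oe i : OL (e i) by apply: (subringD sL); apply: (intclosZ sO).
have OZ c y : OK c -> OL y -> OL (c *: y) by apply: (intclosZ sO).
have alg c (z : L) : c *: z = in_alg L c * z by rewrite mulr_algl.
exists e; split=> // [y Oy|c Oc ce].
  have [c' [Oc' yc']] := gen' y Oy; have [c'' [Oc'' yc'']] := gen'' y Oy.
  exists (fun i => b * c' i + a * c'' i); split=> [i|]; first by apply: subringD => //; apply: subringM.
  pose Y' := \sum_i c' i *: e' i; pose Y'' := \sum_i c'' i *: e'' i.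
  pose Z := \sum_i (c' i *: e'' i + c'' i *: e' i).
  have -> : y - \sum_i (b * c' i + a * c'' i) *: e i
     = b *: (b *: (y - Y')) + a *: (a *: (y - Y'')) + (a * b) *: (y + y - Z).
    have -> : \sum_i (b * c' i + a * c'' i) *: e i
       = (b * b) *: Y' + (a * a) *: Y'' + (a * b) *: Z.
      rewrite !scaler_sumr -!big_split; apply: eq_bigr => i _ /=.
      by rewrite /e !alg !(rmorphD, rmorphM); ring.
    have y1 : y = (a + b) ^+ 2 *: y by rewrite ab expr1n scale1r.
    by rewrite {1}y1 !alg rmorphXn !(rmorphD, rmorphM); ring.
  apply: (idealD iNL); last first.
    apply: ext_idealZ; first exact: mn.
    apply: (subringB sL); first exact: (subringD sL).
    by apply: (subring_sum sL) => i _; apply: (subringD sL); apply: OZ.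
  have H c z : OK c -> ext_ideal OL n z -> ext_ideal OL n (c *: z).
    by move=> Oc nz; rewrite -mulr_algl; apply: (idealMl iNL) => //; apply: (intclos_alg sO).
  apply: (idealD iNL); first by apply: H => //; apply: bM.
  by apply: H => //; apply: aP.
have cm : forall i, m (c i).
  apply: ind' => //.
  have -> : \sum_i c i *: e' i = \sum_i c i *: e i + a *: \sum_i c i *: (e' i - e'' i).
    rewrite scaler_sumr -big_split; apply: eq_bigr => i _ /=; rewrite /e.
    have -> : b = 1 - a by rewrite -ab addrAC subrr add0r.
    by rewrite !alg !(rmorphB, rmorph1); ring.
  apply: (idealD iML); first exact: ext_ideal_mono nm _ ce.
  apply: ext_idealZ => //; apply: (subring_sum sL) => i _; apply: OZ => //.
  exact: (subringB sL).
have cp : forall i, p (c i).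
  apply: ind'' => //.
  have -> : \sum_i c i *: e'' i = \sum_i c i *: e i + b *: \sum_i c i *: (e'' i - e' i).
    rewrite scaler_sumr -big_split; apply: eq_bigr => i _ /=; rewrite /e.
    have -> : a = 1 - b by rewrite -ab addrK.
    by rewrite !alg !(rmorphB, rmorph1); ring.
  apply: (idealD iPL); first exact: ext_ideal_mono np _ ce.
  apply: ext_idealZ => //; apply: (subring_sum sL) => i _; apply: OZ => //.
  exact: (subringB sL).
move=> i; rewrite -[c i]mulr1 -ab mulrDr; apply: (idealD iN); last exact: mn.
by rewrite mulrC; apply: mn.
Qed.
End Residue.

(** * Finite reduced rings and finite fields *)

Section FiniteReduced.
Variable B : finComNzRingType.
Hypothesis redB : forall x : B, x ^+ 2 = 0 -> x = 0.

Lemma reduced_expr (x : B) m : x ^+ m.+1 = 0 -> x = 0.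
Proof.
elim: m => [|m IH]; first by rewrite expr1.
move=> xm; apply: IH; apply: redB; rewrite -exprM mulnC.
by rewrite mul2n -addnn addSnnS exprD xm mulr0.
Qed.

Lemma idempotent_power (x : B) : exists m, x ^+ m.+1 * x ^+ m.+1 = x ^+ m.+1.
Proof.
have [i [j [ij e]]] : exists i j, (i < j)%N /\ x ^+ i = x ^+ j.
  apply: contrapT => H.
  have inj : injective (fun i : 'I_#|B|.+1 => x ^+ i).
    move=> i j e; apply: val_inj; case: (ltngtP i j) => // lt; case: H.
      by exists i, j.
    by exists j, i.
  by have := leq_card _ inj; rewrite card_ord ltnn.
pose t := (j - i)%N; have t0 : (0 < t)%N by rewrite subn_gt0.
have step k l : (i <= k)%N -> x ^+ (k + l * t) = x ^+ k.
  move=> ik; elim: l => [|l IH]; first by rewrite mul0n addn0.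
  have ikl : (i <= k + l * t)%N by apply: leq_trans ik _; apply: leq_addr.
  rewrite mulSn addnCA addnC -[in RHS]IH -{1 2}(subnK ikl) -addnA subnKC ?(ltnW ij) //.
  by rewrite !exprD e.
(* The powers have period [t] from [i] on; [i.+1 * t] is a positive multiple of the period not below
   [i]. *)
exists (i.+1 * t).-1; rewrite prednK ?muln_gt0 // -exprD step //.
by apply: leq_trans (leqnSn i) _; rewrite -{1}[i.+1]muln1 leq_mul2l t0 orbT.
Qed.

(* A minimal idempotent generates a factor of [B] that is a field. *)
Lemma minimal_idempotent (b : B) : b != 0 -> exists c, let eps := c * b in
  [/\ eps * eps = eps, eps != 0 & forall x y, eps * (x * y) = 0 -> eps * x = 0 \/ eps * y = 0].
Proof.
move=> b0.
have idem (x : B) : x != 0 -> exists m, let e := x ^+ m.+1 in e * e = e /\ e != 0.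
  move=> x0; have [m me] := idempotent_power x; exists m; split=> //.
  by apply: contraNneq x0 => /reduced_expr->.
pose Q := [pred e : B | [&& e * e == e, e != 0 & [exists c, e == c * b]]].
have [m [me m0]] := idem b b0.
have Qm : Q (b ^+ m.+1).
  by rewrite /= me eqxx m0; apply/existsP; exists (b ^+ m); rewrite exprSr.
case: (@arg_minnP _ _ Q (fun e => #|[set e * x | x in B]|) Qm) => eps.
case/and3P => /eqP ee e0 /existsP[c /eqP ec] min; exists c; rewrite -ec; split=> // x y exy.
have [->|ex0] := eqVneq (eps * x) 0; [by left | right].
(* An idempotent power [e'] of [eps * x] generates an ideal inside that of [eps]. Minimality makes
   them equal, so [eps = e'], and [e'] kills [y]. *)
have [k] := idem _ ex0; set e' := (eps * x) ^+ k.+1 => -[e'e' e'0].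
have eX j : eps ^+ j.+1 = eps by elim: j => [|j IH] //; rewrite exprS IH.
have e'E : e' = eps * x ^+ k.+1 by rewrite /e' exprMn eX.
have Qe' : Q e'.
  rewrite /= e'e' eqxx e'0 e'E ec; apply/existsP; exists (c * x ^+ k.+1).
  by apply/eqP; ring.
have sub : [set e' * u | u in B] \subset [set eps * u | u in B].
  apply/subsetP => _ /imsetP[u _ ->]; apply/imsetP; exists (x ^+ k.+1 * u) => //.
  by rewrite mulrA -e'E.
have eqs : [set e' * u | u in B] = [set eps * u | u in B].
  by apply/eqP; rewrite eqEcard sub min.
have : eps \in [set e' * u | u in B] by rewrite eqs; apply/imsetP; exists 1; rewrite ?mulr1.
case/imsetP => u _ eu; have e'eps : eps = e'.
  by rewrite [LHS]eu -[in LHS]e'e' -mulrA -eu e'E mulrAC ee.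
rewrite e'eps /e' exprSr -mulrA; have -> : eps * x * y = eps * (x * y) by ring.
by rewrite exy mulr0.
Qed.
End FiniteReduced.

(** Pulls [minimal_idempotent] back to [S]. The prime is the annihilator of [eps] modulo [I]; that
    [eps] is a multiple of [y] is what links it to the given element. *)
Lemma reduced_component (R : comNzRingType) (S I : R -> Prop) N (y : R) :
  subring S -> ideal_of S I -> ~ I 1 -> quot_card S I N ->
  (forall x, S x -> I (x ^+ 2) -> I x) -> S y -> ~ I y ->
  exists c, let eps := c * y in
  [/\ S c, prime_ideal S (fun x => S x /\ I (eps * x)), I (eps * (eps - 1)) & ~ I eps].
Proof.
move=> sS iI I1 qI red Sy nIy; have [B [phi [Q _]]] := quot_ring_exists sS iI I1 qI.
have redB (x : B) : x ^+ 2 = 0 -> x = 0.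
  have [u Su <-] := qm_surj Q x.
  by rewrite -(qmX sS Q) // !(qm_eq0 Q) //; [apply: red | apply: (subringX sS)].
have y0 : phi y != 0 by apply/eqP => /(qm_eq0 Q Sy).
have [c' /= [ee e0 pe]] := minimal_idempotent redB y0.
have [c Sc ec] := qm_surj Q c'; exists c => /=; rewrite -{c'}ec in ee e0 pe.
have Scy := subringM sS Sc Sy; rewrite -(qmM Q) // in ee e0 pe.
set eps := c * y in Scy ee e0 pe *.
have nIe : ~ I eps by move=> /(qm_eq0 Q Scy); apply/eqP.
split=> //.
  split.
    split; last by rewrite mulr1 => -[].
    split.
    - by move=> x [].
    - by rewrite mulr0; split; [apply: subring0 | apply: (ideal0 iI)].
    - by move=> u v [Su Iu] [Sv Iv]; rewrite mulrDr; split; [apply: subringD | apply: (idealD iI)].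
    - by move=> r u Sr [Su Iu]; rewrite mulrCA; split; [apply: subringM | apply: (idealMl iI)].
  move=> u v Su Sv [Suv Iuv].
  have M z : S z -> phi (eps * z) = 0 <-> I (eps * z).
    by move=> Sz; apply: (qm_eq0 Q); apply: (subringM sS).
  have [] := pe (phi u) (phi v).
  - by rewrite -(qmM Q Su Sv) -(qmM Q Scy Suv); apply/M.
  - by rewrite -(qmM Q Scy Su) => /(M _ Su); left.
  - by rewrite -(qmM Q Scy Sv) => /(M _ Sv); right.
rewrite mulrBr mulr1; apply/(qm_eq sS Q) => //; first exact: subringM.
by rewrite (qmM Q).
Qed.

Section FiniteField.
Variable F : finFieldType.

Lemma finField_expr_dvd N : (0 < N)%N -> (forall x : F, x ^+ N = x) -> (#|F| - 1 %| N - 1)%N.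
Proof.
move=> N0 xN; rewrite !subn1 -card_finField_unit.
have /cyclicP[g gE] := field_unit_group_cyclic [set: {unit F}]%G.
rewrite gE -orderE order_dvdn; apply/eqP; apply: val_inj; rewrite FinRing.val_unitX /=.
have g0 : val g != 0 by rewrite -unitfE; apply: (valP g).
by apply: (mulIf g0); rewrite mul1r -exprSr prednK.
Qed.

Lemma finField_expr N : (0 < N)%N -> (#|F| - 1 %| N - 1)%N -> forall x : F, x ^+ N = x.
Proof.
move=> N0 /dvdnP[k kE] x; have [->|x0] := eqVneq x 0; first by rewrite expr0n eqn0Ngt N0.
have x1 : x ^+ (#|F| - 1) = 1.
  apply: (mulfI x0); rewrite -exprS subn1 prednK ?expf_card ?mulr1 //.
  by apply: ltnW; apply: finNzRing_gt1.
by rewrite -(subnK N0) kE exprD mulnC exprM x1 expr1n mul1r.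
Qed.

Variables (q f : nat).
Hypotheses (q1 : (1 < q)%N) (cF : #|F| = (q ^ f)%N).

(** The polynomial has degree at most [q^(f-1)], less than the number of elements of [F]. General
    [v] serve for the invertibility of [W] below, [v = 1] for the nonvanishing of the trace. *)
Lemma linearized_nonvanishing (v : 'I_f -> F) : (exists j, v j != 0) ->
  exists x, \sum_j v j * x ^+ (q ^ j) != 0.
Proof.
move=> [j0 vj0]; apply: contrapT => H.
have {}H x : \sum_j v j * x ^+ (q ^ j) = 0.
  by apply/eqP; apply: contrapT => /negP ne; apply: H; exists x.
pose g : {poly F} := \sum_j v j *: 'X^(q ^ j).
have g0 : g != 0.
  apply: contraNneq vj0 => /(congr1 (fun r : {poly F} => r`_(q ^ j0))).
  rewrite coef0 coef_sum (bigD1 j0) //= big1 => [|j jj].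
    by rewrite coefZ coefXn eqxx mulr1 addr0 => ->.
  by rewrite coefZ coefXn eqn_exp2l // eq_sym -val_eqE in jj *; rewrite (negbTE jj) mulr0.
have f0 : (0 < f)%N by apply: leq_trans (ltn_ord j0).
have sg : (size g <= (q ^ f.-1).+1)%N.
  apply: (leq_trans (size_sum _ _ _)); apply/bigmax_leqP => j _.
  apply: (leq_trans (size_scale_leq _ _)); rewrite size_polyXn ltnS leq_exp2l //.
  by rewrite -ltnS prednK.
have := max_poly_roots g0 (rs := enum F).
rewrite enum_uniq -cardE cF => /(_ _ isT) lt.
have {lt} : (q ^ f < size g)%N.
  apply: lt; apply/allP => x _; rewrite rootE /g horner_sum -[X in _ == X](H x).
  by apply/eqP; apply: eq_bigr => j _; rewrite hornerZ hornerXn.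
move/leq_trans/(_ sg); rewrite ltnS leqNgt ltn_exp2l //.
by rewrite prednK ?leqnn.
Qed.

Lemma finField_frobenius (J : finType) (g : J -> F) j :
  (\sum_i g i) ^+ (q ^ j) = \sum_i g i ^+ (q ^ j).
Proof.
(* [q] divides the order of [F], hence is a power of the characteristic. *)
have qch : [pchar F].-nat (q ^ j)%N.
  rewrite pnatX; apply/orP; left.
  have f0 : (0 < f)%N.
    by case: (f) cF (finNzRing_gt1 F) => // ->.
  have : (q %| #|F|)%N by rewrite cF dvdn_exp.
  move/pnat_dvd; apply; have [p pr pc] := finPcharP F.
  by rewrite (card_pprimeChar pc) pnatX (eq_pnat _ (pcharf_eq pc)) pnat_id.
apply: (big_morph (fun x => x ^+ (q ^ j))) => [x y|].
  exact: exprDn_pchar.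
by rewrite expr0n eqn0Ngt expn_gt0 ltnW.
Qed.

(* [W = (w_l^(q^j))] diagonalises multiplication by [z] with eigenvalues [z^(q^j)]. *)
Lemma finField_trace (w : 'I_f -> F) (T : 'M[F]_f) z :
  (forall l m, T l m ^+ q = T l m) ->
  (forall l, z * w l = \sum_m T l m * w m) ->
  (forall x, exists2 c : 'I_f -> F, (forall l, c l ^+ q = c l) & x = \sum_l c l * w l) ->
  \tr T = \sum_(j < f) z ^+ (q ^ j).
Proof.
move=> Tq zw span.
have powq x j : x ^+ q = x -> x ^+ (q ^ j) = x :> F.
  by move=> xq; elim: j => [|j IH]; rewrite ?expr1 // expnS exprM xq.
pose W : 'M[F]_f := \matrix_(l, j) w l ^+ (q ^ j).
have uW : W \in unitmx.
  (* A kernel vector would be a linearized polynomial vanishing at every [w l], hence on [F], as it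
     is additive and commutes with scalars fixed by [q]-th powers. *)
  rewrite unitmxE unitfE -det_tr; apply/det0P => -[v v0 /rowP vW].
  have [|x] := @linearized_nonvanishing (fun j => v 0 j).
    apply: contrapT => H; case/eqP: v0; apply/rowP => j; rewrite mxE.
    by apply/eqP; apply: contrapT => /negP ne; apply: H; exists j.
  have [c cq ->] := span x; case/eqP.
  under eq_bigr => j _.
    rewrite finField_frobenius mulr_sumr.
    under eq_bigr => l _ do rewrite exprMn (powq _ _ (cq l)) mulrCA.
    over.
  rewrite exchange_big /= big1 // => l _; rewrite -mulr_sumr.
  have := vW l; rewrite !mxE => E; rewrite [X in _ * X](_ : _ = 0) ?mulr0 // -[RHS]E.
  by apply: eq_bigr => j _; rewrite !mxE.
have TW : T *m W = W *m diag_mx (\row_j z ^+ (q ^ j)).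
  rewrite mul_mx_diag; apply/matrixP => l j; rewrite !mxE mulrC -exprMn zw finField_frobenius.
  by apply: eq_bigr => m _; rewrite !mxE exprMn (powq _ _ (Tq l m)).
rewrite -[T](mulmxK uW) TW mxtrace_mulC mulmxA mulVmx // mul1mx mxtrace_diag.
by apply: eq_bigr => j _; rewrite mxE.
Qed.
End FiniteField.

(** In a full-rank factorization [A = C R], [A^2 = 0] forces [R C = 0], and [A] and [R C] have the
    same trace. *)
Lemma mxtrace_sqr0 (F : fieldType) m (A : 'M[F]_m) : A *m A = 0 -> \tr A = 0.
Proof.
move=> AA; rewrite -(mulmx_base A) mxtrace_mulC.
suff -> : row_base A *m col_base A = 0 by rewrite mxtrace0.
have E : col_base A *m (row_base A *m col_base A) *m row_base A = 0.
  transitivity ((col_base A *m row_base A) *m (col_base A *m row_base A)); first by rewrite !mulmxA.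
  by rewrite mulmx_base AA.
apply: (row_full_inj (col_base_full A)); rewrite mulmx0.
by apply: (row_free_inj (row_base_free A)); rewrite mul0mx.
Qed.

(** * Ramification and the discriminant *)

Section Ramification.
Variables (K : fieldType) (L : fieldExtType K) (OK : K -> Prop).
Hypothesis dK : dedekind OK.
Local Notation d := (\dim {:L}).
Local Notation OL := (@intclos K L OK).
Let sO := ded_subring dK.
Let sL := @intclos_subring K OK sO L.

(** If [nL] were everything, every combination of the basis would lie in it, so independence and
    [d > 0] would put [1] in [n]. *)
Lemma ext_ideal_proper n : ideal_of OK n -> residue_degree OK OL n (ext_ideal OL n) d ->
  ~ n 1 -> ~ ext_ideal OL n 1.
Proof.
move=> iN [e [Oe _ ind]] n1 nL1; have iNL := ext_ideal_ideal L dK iN.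
pose i0 := Ordinal (adim_gt0 {:L}%AS); apply: n1.
suff /(_ i0) : forall i, n (i == i0)%:R by rewrite eqxx.
apply: ind => [i|]; first by case: eqP => _; [apply: subring1 | apply: subring0].
apply: (ideal1 iNL nL1); apply: (subring_sum sL) => i _; apply: (intclosZ sO) => //.
by case: eqP => _; [apply: subring1 | apply: subring0].
Qed.

Lemma lies_over_prime p P : maximal_ideal OK p -> prime_ideal OL P -> (forall a, p a -> P a%:A) ->
  lies_over OK p P.
Proof.
move=> [[ip _] mp] [[iP P1] _] pP a Oa; split=> [Pa|]; last exact: pP.
pose J x := OK x /\ P x%:A.
have iJ : ideal_of OK J.
  split.
  - by move=> x [].
  - by split; [apply: subring0 | rewrite scale0r; apply: (ideal0 iP)].
  - by move=> x y [Ox Px] [Oy Py]; split; [apply: subringD | rewrite scalerDl; apply: (idealD iP)].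
  - move=> r x Or [Ox Px]; split; first exact: subringM.
    rewrite -scalerA -mulr_algl; apply: (idealMl iP) => //; exact: (intclos_alg sO).
have [|H|[_]] := mp J iJ; first by move=> x px; split; [apply: (ideal_sub ip) | apply: pP].
  by apply: H.
by rewrite scale1r => /P1.
Qed.

Section Local.
Variables (p : K -> Prop) (e : 'I_d -> L) (s : K) (q : nat).
Hypotheses (pp : prime_ideal OK p) (p0 : nonzero_ideal p) (fr : local_frame OK p e s).
Hypothesis (qp : quot_card OK p q).
Let mp : maximal_ideal OK p := ded_maximal dK pp p0.
Let ip : ideal_of OK p. Proof. by case: pp => [[]]. Qed.
Local Notation pL := (ext_ideal OL p).
Let ipL : ideal_of OL pL := ext_ideal_ideal L dK ip.
Let Oe i : OL (e i). Proof. by case: fr. Qed.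
Let Os : OK s. Proof. by case: fr. Qed.
Let ZL a (y : L) : OK a -> OL y -> OL (a *: y). Proof. exact: (intclosZ sO). Qed.
Let pL1 : ~ pL 1.
Proof. by apply: (ext_ideal_proper ip (frame_residue dK pp p0 fr)); case: pp => [[]]. Qed.
Let qpL : quot_card OL pL (q ^ d)%N.
Proof.
apply: (quot_card_residue dK ipL) (frame_residue dK pp p0 fr) qp => a pa.
exact: (ext_ideal_alg L dK).
Qed.

Lemma residue_frobenius a : OK a -> p (a ^+ q - a).
Proof.
move=> Oa; have [k [kap [Q <-]]] := quot_field_exists sO pp qp.
apply/(qm_eq sO Q) => //; first exact: subringX.
by rewrite (qmX sO Q) // expf_card.
Qed.

Lemma frame_trace_ideal (y : L) : OL y -> (forall j, p (trLK (y * e j))) ->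
  forall z, OL z -> p (trLK (y * z)).
Proof.
move=> Oy py z Oz; apply: (frame_cancel pp fr).
  by apply: (trLK_integral dK); apply: (subringM sL).
case: fr => _ _ _ _ /(_ z Oz)[c [Oc E]].
rewrite -trLKZ scalerAr E mulr_sumr; under eq_bigr do rewrite -scalerAr.
by rewrite trLK_sum; apply: (ideal_sum ip) => j _; apply: (idealMl ip).
Qed.

Section Component.
Variables (P : L -> Prop) (eps : L) (f : nat) (F : finFieldType) (phi : L -> F).
Hypotheses (pP : prime_ideal OL P) (over : forall a, p a -> P a%:A).
Hypotheses (rP : residue_degree OK OL p P f) (Q : quot_morph OL P phi) (cF : #|F| = (q ^ f)%N).
Hypotheses (Oeps : OL eps) (P1eps : P (eps - 1)) (epsP : forall x, P x -> pL (eps * x)).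

(* On the component of [OL / pL] cut out by the idempotent [eps] the trace is the trace of the
   residue field [F], i.e. the sum of the powers of Frobenius. *)
Lemma component_trace z : OL z ->
  phi (trLK (eps * z))%:A = \sum_(j < f) phi z ^+ (q ^ j).
Proof.
move=> Oz; have [w [Ow gen ind]] := rP.
have [iP _] := proj1 pP.
have algL a : OK a -> OL a%:A by apply: (intclos_alg sO).
have phiZ a y : OK a -> OL y -> phi (a *: y) = phi a%:A * phi y.
  by move=> Oa Oy; rewrite -[a *: y]mulr_algl (qmM Q) //; apply: algL.
have phi_frob a : OK a -> phi a%:A ^+ q = phi a%:A.
  move=> Oa; rewrite -(qmX sL Q); last exact: algL.
  apply/(qm_eq sL Q); [by apply: (subringX sL); apply: algL | exact: algL |].
  have -> : a%:A ^+ q - a%:A = (a ^+ q - a)%:A :> L.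
    by rewrite exprZn expr1n scalerBl.
  by apply: over; apply: residue_frobenius.
have q1 : (1 < q)%N.
  have [k [kap [_ <-]]] := quot_field_exists sO pp qp; exact: finNzRing_gt1.
have Oez : OL (eps * z) by apply: (subringM sL).
have /choice[C CP] : forall i, exists c : 'I_f -> K,
    (forall l, OK (c l)) /\ P (e i - \sum_l c l *: w l) by move=> i; apply: gen.
have /choice[D DP] : forall l, exists c : 'I_d -> K,
    (forall m, OK (c m)) /\ pL (eps * z * w l - \sum_m c m *: e m).
  by move=> l; apply: (frame_gen dK pp p0 fr); apply: (subringM sL).
(* [Cm] represents the reduction from [OL/pL] to [F], [Dm] the map from [F] to [OL/pL] induced by
   [eps * z]. [Cm *m Dm] is multiplication by [eps * z] and [Dm *m Cm] is multiplication by [z] on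
   [F], so the traces agree. *)
pose Cm : 'M[K]_(d, f) := \matrix_(i, l) C i l; pose Dm : 'M[K]_(f, d) := \matrix_(l, m) D l m.
have OC i l : OK (Cm i l) by rewrite mxE; case: (CP i).
have OD l m : OK (Dm l m) by rewrite mxE; case: (DP l).
have pPL y : pL y -> P y by apply: (ext_ideal_sub iP).
have mulmx_sum m1 m2 m3 (A : 'M[K]_(m1, m2)) (A' : 'M[K]_(m2, m3)) (g : 'I_m3 -> L) i :
    \sum_j (A *m A') i j *: g j = \sum_k A i k *: \sum_j A' k j *: g j.
  under [RHS]eq_bigr do rewrite scaler_sumr.
  rewrite exchange_big; apply: eq_bigr => j _; rewrite mxE scaler_suml.
  by apply: eq_bigr => k _; rewrite scalerA.
have ptr : p (trLK (eps * z) - \tr (Cm *m Dm)).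
  apply: (frame_trace dK pp fr) => // [i j|i].
    by rewrite mxE; apply: (subring_sum sO) => l _; apply: subringM.
  have -> : eps * z * e i - \sum_j (Cm *m Dm) i j *: e j
      = z * (eps * (e i - \sum_l Cm i l *: w l))
        + \sum_l Cm i l *: (eps * z * w l - \sum_m Dm l m *: e m).
    rewrite mulmx_sum; under [X in _ = _ + X]eq_bigr do rewrite scalerBr.
    rewrite sumrB; have -> : \sum_l Cm i l *: (eps * z * w l) = eps * z * \sum_l Cm i l *: w l.
      by rewrite mulr_sumr; apply: eq_bigr => l _; rewrite scalerAr.
    by ring.
  apply: (idealD ipL).
    apply: (idealMl ipL) => //; apply: epsP; have [_] := CP i.
    by congr P; congr (_ - _); apply: eq_bigr => l _; rewrite mxE.
  apply: (ideal_sum ipL) => l _; rewrite -mulr_algl; apply: (idealMl ipL); first exact: algL.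
  have [_] := DP l; congr (ext_ideal _ _ (_ - _)).
  by apply: eq_bigr => m _; rewrite mxE.
pose DC := Dm *m Cm.
have ODC l m : OK (DC l m) by rewrite mxE; apply: (subring_sum sO) => k _; apply: subringM.
have zw l : P (z * w l - \sum_m DC l m *: w m).
  have -> : z * w l - \sum_m DC l m *: w m
     = - (z * w l * (eps - 1)) + (eps * z * w l - \sum_m Dm l m *: e m)
       + \sum_m Dm l m *: (e m - \sum_k Cm m k *: w k).
    rewrite mulmx_sum; under [X in _ = _ + X]eq_bigr do rewrite scalerBr.
    by rewrite sumrB; ring.
  have Ozw : OL (z * w l) by apply: (subringM sL).
  apply: (idealD iP); first apply: (idealD iP).
  - by apply: (idealN sL iP); apply: (idealMl iP).
  - apply: pPL; have [_] := DP l; congr (ext_ideal _ _ (_ - _)).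
    by apply: eq_bigr => m _; rewrite mxE.
  - apply: (ideal_sum iP) => m _; rewrite -mulr_algl; apply: (idealMl iP); first exact: algL.
    have [_] := CP m; congr P; congr (_ - _).
    by apply: eq_bigr => k _; rewrite mxE.
have Otr : OK (\tr (Cm *m Dm)).
  apply: (subring_sum sO) => i _; rewrite mxE.
  by apply: (subring_sum sO) => l _; apply: subringM.
have -> : phi (trLK (eps * z))%:A = phi (\tr (Cm *m Dm))%:A.
  apply/(qm_eq sL Q); [by apply: algL; apply: (trLK_integral dK) | exact: algL |].
  by rewrite -scalerBl; apply: over.
rewrite mxtrace_mulC -/DC /mxtrace scaler_suml (qm_sum sL Q) => [|i _]; last exact: algL.
rewrite -(@finField_trace F q f q1 cF (fun l => phi (w l)) (\matrix_(l, m) phi (DC l m)%:A)).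
- by apply: eq_bigr => i _; rewrite [RHS]mxE.
- by move=> l m; rewrite [X in X ^+ _]mxE [RHS]mxE; apply: phi_frob.
- move=> l; rewrite -(qmM Q) //.
  transitivity (phi (\sum_m DC l m *: w m)).
    apply/(qm_eq sL Q) => //; first exact: (subringM sL).
    by apply: (subring_sum sL) => m _; apply: ZL.
  rewrite (qm_sum sL Q) => [|m _]; last exact: ZL.
  by apply: eq_bigr => m _; rewrite mxE phiZ.
- move=> x; have [y Oy <-] := qm_surj Q x; have [c [Oc yc]] := gen y Oy.
  exists (fun l => phi (c l)%:A); first by move=> l; apply: phi_frob.
  transitivity (phi (\sum_l c l *: w l)).
    by apply/(qm_eq sL Q) => //; apply: (subring_sum sL) => m _; apply: ZL.
  rewrite (qm_sum sL Q) => [|m _]; last exact: ZL.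
  by apply: eq_bigr => m _; rewrite phiZ.
Qed.
End Component.

Lemma unramified_disc N : (1 < N)%N -> (forall a, OL a -> pL (a ^+ N - a)) -> ~ p (disc_elt e).
Proof.
move=> N1 aN pe.
have red x : OL x -> pL (x ^+ 2) -> pL x.
  move=> Ox px; have -> : x = x ^+ 2 * x ^+ (N - 2) - (x ^+ N - x).
    by rewrite -exprD subnKC // opprB addrC subrK.
  by apply: (idealB sL ipL); [apply: (ideal_mulr ipL) => //; apply: (subringX sL) | apply: aN].
(* A kernel vector of the Gram matrix over the residue field, lifted to [OK]. *)
have [v [Ov [i0 nv] vG]] : exists v : 'I_d -> K, [/\ forall i, OK (v i),
    exists i, ~ p (v i) & forall j, p (\sum_i v i * trLK (e i * e j))].
  have [k [kap [Q _]]] := quot_field_exists sO pp qp.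
  have OG i j : OK (trLK (e i * e j)) by apply: (trLK_integral dK); apply: (subringM sL).
  pose G : 'M[K]_d := \matrix_(i, j) trLK (e i * e j).
  have : \det (map_mx kap G) == 0.
    rewrite -(qm_det sO Q) => [|i j]; last by rewrite mxE.
    by apply/eqP/(qm_eq0 Q) => //; apply: (disc_elt_integral dK).
  case/det0P => v v0 /rowP vG.
  have /choice[u uP] : forall i, exists x, OK x /\ kap x = v 0 i.
    by move=> i; have [x Ox E] := qm_surj Q (v 0 i); exists x.
  exists u; split=> [i||j]; first by case: (uP i).
    apply: contrapT => H; case/eqP: v0; apply/rowP => i; rewrite mxE.
    have [Ou <-] := uP i; apply/(qm_eq0 Q Ou).
    by apply: contrapT => npu; apply: H; exists i.
  have Ouj i : OK (u i * trLK (e i * e j)) by apply: subringM => //; case: (uP i).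
  apply/(qm_eq0 Q); first exact: (subring_sum sO).
  rewrite (qm_sum sO Q) //; have E0 := vG j; rewrite !mxE in E0; rewrite -[RHS]E0.
  apply: eq_bigr => i _; have [Ou E] := uP i.
  by rewrite (qmM Q) // E !mxE.
pose y := \sum_i v i *: e i.
have Oy : OL y by apply: (subring_sum sL) => i _; apply: ZL.
have npy : ~ pL y by move=> /(frame_indep pp fr Ov)/(_ i0).
have py : forall j, p (trLK (y * e j)).
  move=> j; have := vG j; rewrite -trLK_sum; congr (p (trLK _)).
  by rewrite mulr_suml; apply: eq_bigr => i _; rewrite scalerAl.
have [c /= [Oc pP P1 neps]] := reduced_component sL ipL pL1 qpL red Oy npy.
set eps := c * y in pP P1 neps; set P := (fun x => _) in pP.
have Oeps : OL eps by apply: (subringM sL).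
have over a : p a -> P a%:A.
  move=> pa; split; first by apply: (intclos_alg sO); apply: (ideal_sub ip).
  by apply: (idealMl ipL) => //; apply: (ext_ideal_alg L dK).
have [iP _] := proj1 pP.
have [|f rP] := residue_degree_exists dK ip iP over mp Oe.
  move=> x Ox; have [a [Oa xa]] := frame_gen dK pp p0 fr Ox; exists a; split=> //.
  split; last by apply: (idealMl ipL).
  by apply: (subringB sL) => //; apply: (subring_sum sL) => i _; apply: ZL.
have [F [phi [Q cF]]] := quot_field_exists sL pP (quot_card_residue dK iP over rP qp).
have q1 : (1 < q)%N.
  have [k [kap [_ <-]]] := quot_field_exists sO pp qp; exact: finNzRing_gt1.
have f0 : (0 < f)%N by case: (f) cF (finNzRing_gt1 F) => // ->.
(* Some [z] has nonzero residue trace, yet [eps * z] is a multiple of [y], so its trace lies in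
   [p]. *)
have [|x] := linearized_nonvanishing q1 cF (v := fun=> 1).
  by exists (Ordinal f0); apply: oner_neq0.
have [z Oz <-] := qm_surj Q x; case/eqP.
under eq_bigr do rewrite mul1r.
rewrite -(component_trace pP over rP Q cF Oeps _ _ Oz).
- apply/(qm_eq0 Q).
    by apply: (intclos_alg sO); apply: (trLK_integral dK); apply: (subringM sL).
  apply: over; have -> : eps * z = y * (c * z) by rewrite /eps; ring.
  by apply: frame_trace_ideal => //; apply: (subringM sL).
- by split=> //; apply: (subringB sL) => //; apply: (subring1 sL).
- by move=> u [].
Qed.

(** If [x^2] is in [pL], so is each [(x e_j)^2], hence all traces of [x e_j] are in [p]. With [G]
    the Gram matrix and [c] the coordinates of [s *: x], [c G] is in [p]; multiplying by the
    adjugate puts [det(G) c] in [p]. *)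
Lemma disc_reduced : ~ p (disc_elt e) -> forall x, OL x -> pL (x ^+ 2) -> pL x.
Proof.
move=> npd x Ox px2.
have tr0 y : OL y -> pL (y ^+ 2) -> p (trLK y).
  move=> Oy py2; have [k [kap [Q _]]] := quot_field_exists sO pp qp.
  have /choice[C CP] : forall i, exists c : 'I_d -> K,
      (forall m, OK (c m)) /\ pL (y * e i - \sum_m c m *: e m).
    by move=> l; apply: (frame_gen dK pp p0 fr); apply: (subringM sL).
  pose T : 'M[K]_d := \matrix_(i, j) C i j.
  have OT i j : OK (T i j) by rewrite mxE; case: (CP i).
  have yT i : pL (y * e i - \sum_m T i m *: e m).
    have [_] := CP i; congr (ext_ideal _ _ (_ - _)).
    by apply: eq_bigr => m _; rewrite mxE.
  move: T OT yT => T OT yT {C CP}.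
  have ptr := frame_trace dK pp fr Oy OT yT.
  have Otr : OK (\tr T) by apply: (subring_sum sO).
  apply: (ideal_congr ip ptr); apply/(qm_eq0 Q Otr); rewrite (qm_sum sO Q) //.
  transitivity (\tr (map_mx kap T)); first by apply: eq_bigr => i _; rewrite mxE.
  apply: mxtrace_sqr0; apply/matrixP => i j; rewrite !mxE.
  transitivity (kap ((T *m T) i j)).
    rewrite mxE (qm_sum sO Q) => [|l _]; last exact: (subringM sO).
    by apply: eq_bigr => l _; rewrite !mxE (qmM Q).
  have OTT l m : OK ((T *m T) l m).
    by rewrite mxE; apply: (subring_sum sO) => u _; apply: subringM.
  apply/(qm_eq0 Q) => //; move: j; apply: (frame_indep pp fr) => //.
  have -> : \sum_j (T *m T) i j *: e j = y ^+ 2 * e i - (y * (y * e i - \sum_m T i m *: e m)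
     + \sum_m T i m *: (y * e m - \sum_j T m j *: e j)).
    under [X in _ = _ - (_ + X)]eq_bigr do rewrite scalerBr.
    rewrite sumrB; have -> : \sum_m T i m *: (y * e m) = y * \sum_m T i m *: e m.
      by rewrite mulr_sumr; apply: eq_bigr => l _; rewrite scalerAr.
    have -> : \sum_j (T *m T) i j *: e j = \sum_m T i m *: \sum_j T m j *: e j.
      under [RHS]eq_bigr do rewrite scaler_sumr.
      rewrite exchange_big; apply: eq_bigr => j _; rewrite mxE scaler_suml.
      by apply: eq_bigr => l _; rewrite scalerA.
    by ring.
  apply: (idealB sL ipL); first by apply: (ideal_mulr ipL).
  apply: (idealD ipL); first exact: (idealMl ipL).
  apply: (ideal_sum ipL) => m _; rewrite -mulr_algl; apply: (idealMl ipL) => //.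
  exact: (intclos_alg sO).
have px j : p (trLK (x * e j)).
  apply: tr0; first exact: (subringM sL).
  by rewrite exprMn; apply: (ideal_mulr ipL) => //; apply: (subringX sL).
apply: (frame_unit dK pp p0 fr Ox).
case: (fr) => _ _ _ _ /(_ x Ox)[c [Oc E]]; rewrite E.
pose G : 'M[K]_d := \matrix_(i, j) trLK (e i * e j).
have OG i j : OK (G i j).
  by rewrite mxE; apply: (trLK_integral dK); apply: (subringM sL).
have cG j : p (((\row_i c i) *m G) 0 j).
  rewrite mxE; under eq_bigr do rewrite !mxE.
  rewrite -trLK_sum; have -> : \sum_i c i *: (e i * e j) = s *: (x * e j).
    by rewrite scalerAl E mulr_suml; apply: eq_bigr => i _; rewrite scalerAl.
  by rewrite trLKZ; apply: (idealMl ip).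
have cd i : p (c i).
  have : p (((\row_i c i) *m G *m \adj G) 0 i).
    rewrite mxE; apply: (ideal_sum ip) => j _; apply: (ideal_mulr ip) => //.
    exact: (subring_adj sO).
  rewrite -mulmxA mul_mx_adj mul_mx_scalar !mxE => H.
  by have [] := proj2 pp _ _ (subring_det sO OG) (Oc i) H.
by apply: (ideal_sum ipL) => i _; apply: ext_idealZ.
Qed.

(** Otherwise some idempotent [eps = c y] modulo [pL] is nonzero and its annihilator is a prime
    above [p]. This prime contains [y], so [eps = eps^2 = c eps y] would be zero. *)
Lemma reduced_ext_ideal (y : L) : ~ p (disc_elt e) -> OL y ->
  (forall P, prime_ideal OL P -> (forall a, p a -> P a%:A) -> P y) -> pL y.
Proof.
move=> npd Oy Py; apply: contrapT => npy.
have [c /= [Oc pP P1 neps]] := reduced_component sL ipL pL1 qpL (disc_reduced npd) Oy npy.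
set eps := c * y in pP P1 neps; have Oeps : OL eps by apply: (subringM sL).
have [|_ pey] := Py _ pP.
  move=> a pa; split; first by apply: (intclos_alg sO); apply: (ideal_sub ip).
  by apply: (idealMl ipL) => //; apply: (ext_ideal_alg L dK).
apply: neps; have -> : eps = c * (eps * y) - eps * (eps - 1) by rewrite /eps; ring.
by apply: (idealB sL ipL) => //; apply: (idealMl ipL).
Qed.
End Local.
End Ramification.

(** * Carmichael ideals *)

Lemma quot_field_prime (R : comNzRingType) (S I : R -> Prop) : subring S -> ideal_of S I ->
  quot_is_field S I -> prime_ideal S I.
Proof.
move=> sS iI [I1 inv]; split=> // x y Sx Sy Ixy.
have [?|nIx] := pselect (I x); [by left | right].
have [z [Sz Iz]] := inv x Sx nIx.
have -> : y = z * (x * y) - y * (x * z - 1) by ring.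
by apply: (idealB sS iI); apply: (idealMl iI).
Qed.

Lemma carmichael_prime_field (R : comNzRingType) (S I : R -> Prop) N : subring S ->
  prime_ideal S I -> (1 < N)%N -> (forall a, S a -> I (a ^+ N - a)) -> quot_is_field S I.
Proof.
move=> sS [[iI I1] pI] N1 aN; split=> // x Sx nIx.
exists (x ^+ (N - 2)); split; first exact: subringX.
have NE : (N - 2).+2 = N by rewrite -addn2 subnK.
have Sy : S (x * x ^+ (N - 2) - 1).
  by apply: subringB => //; [apply: subringM => //; apply: subringX | apply: subring1].
have [|//|//] := pI x _ Sx Sy.
by rewrite mulrBr mulr1 -!exprS NE; apply: aN.
Qed.

Theorem theorem3p2 (K : fieldType) (L : fieldExtType K)
    (OK : K -> Prop) (n : K -> Prop) (Nn : nat) :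
  dedekind OK ->
  separable 1%VS (fullv : {vspace L}) ->
  ideal_of OK n -> nonzero_ideal n -> square_free OK n ->
  quot_card OK n Nn ->
  carmichael_ideal (@intclos K L OK) (ext_ideal (@intclos K L OK) n) <->
  [/\ composite_ideal (@intclos K L OK) (ext_ideal (@intclos K L OK) n),
      coprime_ideals n (disc_ideal OK (@intclos K L OK)) &
      forall (p : K -> Prop) (P : L -> Prop) (f Np : nat),
        prime_ideal OK p -> (forall x, n x -> p x) ->
        prime_ideal (@intclos K L OK) P -> lies_over OK p P ->
        residue_degree OK (@intclos K L OK) p P f ->
        quot_card OK p Np ->
        (Np ^ f - 1 %| Nn ^ (\dim (fullv : {vspace L})) - 1)%N].
Proof.
move=> dK sep iN n0 sqf qn; have sO := ded_subring dK.
set OL := @intclos K L OK; have sL : subring OL by apply: intclos_subring.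
have n1 : ~ n 1 by case: sqf.
have pnz p : (forall x, n x -> p x) -> nonzero_ideal p.
  by have [x [nx x0]] := n0 => np; exists x; split=> //; apply: np.
have cN : locally_coprime_colon OK n.
  by move=> p pp np; apply: (square_free_colon dK pp (pnz p np)).
have rN := ext_ideal_residue dK sep iN n0 cN.
have iNL := ext_ideal_ideal L dK iN; rewrite -/OL in rN iNL.
have nL1 := ext_ideal_proper dK iN rN n1; rewrite -/OL in nL1.
have qN := quot_card_residue dK iNL (fun a na => ext_ideal_alg L dK na) rN qn.
have N1 : (1 < Nn ^ \dim {:L})%N.
  by have [B [_ [_ <-]]] := quot_ring_exists sL iNL nL1 qN; apply: finNzRing_gt1.
split=> [[N [qN' nf aN]]|[[nz pr npr] cop div]].
  (* The exponent in [carmichael_ideal] is the size of the quotient, which is unique. *)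
  have eN : N = (Nn ^ \dim {:L})%N by apply: (quot_card_uniq sL iNL).
  rewrite eN in aN.
  split.
  - split; [|by split|].
      have [x [nx x0]] := n0; exists x%:A; split; first exact: (ext_ideal_alg L dK).
      by rewrite scaler_eq0 negb_or x0 oner_neq0.
    by move=> prN; apply: nf; apply: (carmichael_prime_field sL prN N1 aN).
  - apply: contrapT => ncop.
    have iD := disc_ideal_ideal L dK.
    have iJ := ideal_addition sO iN iD.
    (* A maximal ideal containing both [n] and the discriminant contains the discriminant of its own
       frame, against [unramified_disc]. *)
    have [|p mp Jp] := exists_maximal sO (ded_noetherian dK) iJ.
      by move=> [a [b [na Db ab]]]; apply: ncop; exists a, b.
    have pp := maximal_prime sO mp.
    have np x : n x -> p x.
      by move=> nx; apply: Jp; exists x, 0; rewrite addr0; split=> //; apply: (ideal0 iD).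
    have p0 := pnz p np; have [ip _] := proj1 pp.
    have [e [s fr]] := exists_local_frame dK sep pp p0.
    have [q qp] := quot_card_sup sO ip np qn.
    apply: (unramified_disc dK pp p0 fr qp N1) => [a Oa|].
      by apply: (ext_ideal_mono np); apply: aN.
    apply: Jp; exists 0, (disc_elt e); rewrite add0r; split=> //; first exact: (ideal0 iN).
    by apply: (gen_ideal_incl sO); exists e; split=> //; case: fr.
  - move=> p P f Np pp np pP lo rP qp; have [ip _] := proj1 pp; have [iP _] := proj1 pP.
    have pPa a : p a -> P a%:A by move=> pa; apply/(lo a (ideal_sub ip pa)).
    have [F [phi [Q <-]]] := quot_field_exists sL pP (quot_card_residue dK iP pPa rP qp).
    apply: finField_expr_dvd => [|x]; first exact: ltnW.
    have [a Oa <-] := qm_surj Q x; rewrite -(qmX sL Q) //.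
    apply/(qm_eq sL Q) => //; first exact: (subringX sL).
    by apply: (ext_ideal_sub iP) (aN a Oa) => b nb; apply: pPa; apply: np.
exists (Nn ^ \dim {:L})%N; split=> //.
  by move=> H; apply: npr; apply: (quot_field_prime sL iNL).
move=> a Oa; have OaN : OL (a ^+ (Nn ^ \dim {:L}) - a).
  by apply: (subringB sL) => //; apply: (subringX sL).
(* The identity is checked modulo each [pL], and there, [pL] being an intersection of primes, in
   each residue field. *)
apply: (ext_ideal_local dK iN cN OaN) => p pp np; have p0 := pnz p np.
have [ip p1] := proj1 pp; have mp := ded_maximal dK pp p0.
have [e [s fr]] := exists_local_frame dK sep pp p0.
have [q qp] := quot_card_sup sO ip np qn.
apply: (reduced_ext_ideal dK pp p0 fr qp) => // [pe|P pP pPa].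
  have [x [y [nx Dy xy]]] := cop; apply: p1; rewrite -xy; apply: (idealD ip); first exact: np.
  move: y Dy {xy}; apply: gen_ideal_ind; [exact: (ideal0 ip) | exact: (idealD ip) |].
  move=> r _ Or [z [Oz ->]]; apply: (idealMl ip) => //.
  exact: (frame_disc dK pp fr Oz pe).
have [iP _] := proj1 pP.
have [||f rP] := residue_degree_exists dK ip iP pPa mp (e0 := e).
- by case: fr.
- move=> y Oy; have [c [Oc yc]] := frame_gen dK pp p0 fr Oy; exists c; split=> //.
  exact: (ext_ideal_sub iP pPa).
have lo := lies_over_prime dK mp pP pPa.
have [F [phi [Q cF]]] := quot_field_exists sL pP (quot_card_residue dK iP pPa rP qp).
apply/(qm_eq sL Q) => //; first exact: (subringX sL).
rewrite (qmX sL Q) //; apply: finField_expr; first exact: ltnW.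
by rewrite cF; apply: (div p P f q).
Qed.
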